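(* Let $\Lambda$ be a compact invariant set without singularities for the $C^1$ vector field $X$ on $M$. Suppose that there exists a continuous $DX_t$-invariant decomposition of the tangent bundle over $\Lambda$, $T_{\Lambda}M = E \oplus F$, where $E$ is uniformly contracted and $F$ is sectionally expanding. Then $\Lambda$ is a hyperbolic set.
   Context: $M$ is a connected compact finite-dimensional Riemannian manifold of dimension $n\ge 3$, with or without boundary; $X$ is inwardly transverse to $\partial M$ if $\partial M\neq\emptyset$; $\{X_t\}$ is the flow generated by $X$, and $DX_t$ its derivative. A set $\Lambda$ is invariant if $X_t(\Lambda)=\Lambda$ for all $t\in\mathbb{R}$. A singularity is a point $\sigma$ with $X(\sigma)=0$. A splitting is $DX_t$-invariant if $DX_t$ maps each fiber at $x$ onto the corresponding fiber at $X_t(x)$, for all $x\in\Lambda$, $t\in\mathbb{R}$. A $DX_t$-invariant subbundle $E$ is uniformly contracted if there are $C,\lambda>0$ with $\|DX_t|_{E_x}\|\le Ce^{-\lambda t}$ for all $x\in\Lambda$, $t\ge0$. A $DX_t$-invariant subbundle $F\subset T_\Lambda M$ is sectionally expanding if $\dim F_x\ge2$ is constant for $x\in\Lambda$ and there are $C,\lambda>0$ such that for every $x\in\Lambda$ and every two-dimensional linear subspace $L_x\subset F_x$ one has $|\det(DX_t|_{L_x})|>Ce^{\lambda t}$ for all $t>0$. A compact invariant set $\Lambda$ is hyperbolic if there is a continuous $DX_t$-invariant splitting $T_\Lambda M=E^s\oplus E^X\oplus E^u$, where $E^X$ is the direction of the vector field, and $K,\lambda>0$ with $\|DX_t|_{E^s_x}\|\le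 Ke^{-\lambda t}$ and $\|DX_{-t}|_{E^u_x}\|\le Ke^{-\lambda t}$ for all $x\in\Lambda$, $t\ge0$. *)

(* Defs.v *)
From HB Require Import structures.
From mathcomp Require Import all_boot all_order all_algebra.
From mathcomp Require Import all_classical all_reals all_analysis.

Set Implicit Arguments.
Unset Strict Implicit.
Unset Printing Implicit Defensive.

Import Order.TTheory GRing.Theory Num.Theory.
Import numFieldNormedType.Exports.

Local Open Scope classical_set_scope.
Local Open Scope ring_scope.

Section Calculus.
Variables (R : realType) (V W : normedModType R).

(* For U open in a finite-dimensional V this is the usual C^k: the
   derivatives in all directions are C^(k-1), recursively. *)
Fixpoint Ck (k : nat) (U : set V) (f : V -> W) : Prop :=
  if k is k'.+1 then
    (forall x, U x -> differentiable f x) /\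
    (forall v, Ck k' U (fun x => 'D_v f x))
  else forall x, U x -> {for x, continuous f}.

(* Regularity on an arbitrary set A: near each point of A, f is the
   restriction to A of a function of that regularity on an open set of V. *)
Definition C1_on (A : set V) (f : V -> W) : Prop :=
  forall x, A x -> exists U : set V, exists h : V -> W,
    [/\ open U, U x, Ck 1 U h & forall y, A y -> U y -> f y = h y].

Definition smooth_on (A : set V) (f : V -> W) : Prop :=
  forall x, A x -> exists U : set V, exists h : V -> W,
    [/\ open U, U x, forall k, Ck k U h & forall y, A y -> U y -> f y = h y].

(* L is meant to be linear. *)
Definition has_deriv_within (S : set V) (f : V -> W) (x : V) (L : V -> W) :
    Prop :=
  forall e : R, 0 < e ->
    \forall z \near within S (nbhs x),
      `|f z - f x - L (z - x)| <= e * `|z - x|.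

End Calculus.

(* Vectors are rows, so the Jacobian acts on the right, as 'J does.  It is
   determined as soon as S is a neighbourhood of x in a half-space. *)
Definition jac_within (R : realType) (m n : nat) (S : set 'rV[R]_m)
    (f : 'rV[R]_m -> 'rV[R]_n) (x : 'rV[R]_m) : 'M[R]_(m, n) :=
  get [set A | has_deriv_within S f x (fun v => v *m A)].

Definition half_space (R : realType) (n : nat) : set 'rV[R]_n :=
  [set y | forall i : 'I_n, i = 0%N :> nat -> 0 <= y 0 i].

Record chart (R : realType) (n : nat) (M : topologicalType) := Chart {
  csrc : set M;
  ctgt : set 'rV[R]_n;
  coord :> M -> 'rV[R]_n;
  cinv : 'rV[R]_n -> M;
  csrc_open : open csrc;
  ctgt_open : exists2 O : set 'rV[R]_n, open O & ctgt = O `&` @half_space R n;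
  coordK : forall p, csrc p -> ctgt (coord p) /\ cinv (coord p) = p;
  cinvK : forall y, ctgt y -> csrc (cinv y) /\ coord (cinv y) = y;
  coord_continuous : {within csrc, continuous coord};
  cinv_continuous : {within ctgt, continuous cinv}
}.

(* Smooth n-manifolds with (possibly empty) boundary.  The atlas is indexed by
   the points: it consists of one chart at each point, with smooth transition
   maps. *)
Record manifold (R : realType) (n : nat) := Manifold {
  space :> topologicalType;
  chart_at : space -> chart R n space;
  chart_atP : forall p, csrc (chart_at p) p;
  transition_smooth : forall p q,
    smooth_on [set y | ctgt (chart_at p) y /\
                       csrc (chart_at q) (cinv (chart_at p) y)]
              (fun y => chart_at q (cinv (chart_at p) y));
  space_hausdorff : hausdorff_space space;
  space_second_countable : @second_countable space
}.

Section Manifolds.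
Variables (R : realType) (n : nat) (M : manifold R n).

Definition boundary : set M :=
  [set p | exists2 i : 'I_n, i = 0%N :> nat & chart_at p p 0 i = 0].

(* The tangent space T_pM is 'rV_n, a tangent vector at p being given by its
   components in the chart [chart_at p].  The following matrix turns
   components, with respect to the chart a, of vectors of T_pM into components
   with respect to b. *)
Definition change_coord (a b : chart R n M) (p : M) : 'M[R]_n :=
  jac_within [set y | ctgt a y /\ csrc b (cinv a y)]
             (fun y => b (cinv a y)) (a p).

Definition C1_vector_field (X : M -> 'rV[R]_n) : Prop :=
  forall p, let c := chart_at p in
    C1_on (ctgt c)
      (fun y => let q := cinv c y in X q *m change_coord (chart_at q) c q).

Definition inwardly_transverse (X : M -> 'rV[R]_n) : Prop :=
  forall p, boundary p -> forall i : 'I_n, i = 0%N :> nat -> 0 < X p 0 i.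

(* The inner product on T_pM is (v, w) |-> v *m g p *m w^T. *)
Definition riemannian_metric (g : M -> 'M[R]_n) : Prop :=
  [/\ forall p, (g p)^T = g p,
      forall p (v : 'rV[R]_n), v != 0 -> 0 < (v *m g p *m v^T) 0 0
    & forall p, let c := chart_at p in
        smooth_on (ctgt c)
          (fun y => let q := cinv c y in
             let T := change_coord c (chart_at q) q in T *m g q *m T^T)].

Definition integral_curve (X : M -> 'rV[R]_n) (J : set R) (c : R -> M) :
    Prop :=
  {within J, continuous c} /\
  forall t, J t ->
    has_deriv_within (V := R^o) J (fun s => chart_at (c t) (c s)) t
      (fun s : R^o => (s : R) *: X (c t)).

(* [phi t p] is X_t(p), which is meaningful only for (t, p) in D: orbits may
   leave M through the boundary in negative time.  The first six clauses say
   that [phi ^~ p], on its interval of definition, is the maximal integral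
   curve of X through p.  The last three record the standard regularity of the
   flow of a C^1 vector field; when M has no boundary the first of them says
   that D is open. *)
Record is_flow (X : M -> 'rV[R]_n) (D : set (R * M)) (phi : R -> M -> M) :
    Prop := IsFlow {
  flow_interval : forall p, is_interval [set t | D (t, p)];
  flow_dom0 : forall p, D (0, p);
  flow0 : forall p, phi 0 p = p;
  flow_integral : forall p, integral_curve X [set t | D (t, p)] (phi ^~ p);
  flow_maximal : forall p (J : set R) (c : R -> M),
    is_interval J -> J 0 -> c 0 = p -> integral_curve X J c ->
    forall t, J t -> D (t, p);
  flow_unique : forall p (J : set R) (c : R -> M),
    is_interval J -> J 0 -> c 0 = p -> integral_curve X J c ->
    forall t, J t -> c t = phi t p;
  flow_dom_nbhs : forall t p,
    D (t, p) -> ~ boundary (phi t p) -> nbhs (t, p) D;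
  flow_continuous : {within D, continuous (fun z : R * M => phi z.1 z.2)};
  flow_C1 : forall p q, let a := chart_at p in let b := chart_at q in
    C1_on [set z : (R^o * 'rV[R]_n)%type |
             [/\ ctgt a z.2, D (z.1, cinv a z.2)
               & csrc b (phi z.1 (cinv a z.2))]]
          (fun z => b (phi z.1 (cinv a z.2)))
}.

(* DX_t at p, as a map from T_pM to the tangent space at X_t(p). *)
Definition dflow (D : set (R * M)) (phi : R -> M -> M) (t : R) (p : M) :
    'M[R]_n :=
  let a := chart_at p in let b := chart_at (phi t p) in
  jac_within [set y | ctgt a y /\ D (t, cinv a y)]
             (fun y => b (phi t (cinv a y))) (a p).

Definition invariant_set (D : set (R * M)) (phi : R -> M -> M) (L : set M) :
    Prop :=
  forall t : R, (forall x, L x -> D (t, x)) /\ phi t @` L = L.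

(* Subbundles of T_L M are families of row spaces.  Continuity: local frames
   that are continuous in a chart. *)
Definition continuous_subbundle (L : set M) (E : M -> 'M[R]_n) : Prop :=
  forall x, L x -> exists U : set M, exists B : M -> 'M[R]_(\rank (E x), n),
    [/\ open U, U x, U `<=` csrc (chart_at x),
        {within L `&` U, continuous B}
      & forall y, L y -> U y ->
          row_free (B y) /\
          (B y == E y *m change_coord (chart_at y) (chart_at x) y)%MS].

Definition invariant_subbundle (D : set (R * M)) (phi : R -> M -> M)
    (L : set M) (E : M -> 'M[R]_n) : Prop :=
  forall t x, L x -> (E x *m dflow D phi t x == E (phi t x))%MS.

Section Metric.
Variable g : M -> 'M[R]_n.

Definition tnorm (p : M) (v : 'rV[R]_n) : R :=
  Num.sqrt ((v *m g p *m v^T) 0 0).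

(* Operator norm of the restriction to V of the map A from T_pM to T_qM. *)
Definition opnorm (p q : M) (A V : 'M[R]_n) : \bar R :=
  ereal_sup [set (tnorm q (v *m A))%:E |
             v in [set v : 'rV[R]_n | (v <= V)%MS /\ tnorm p v <= 1]].

Definition gram (p : M) (k : nat) (B : 'M[R]_(k, n)) : 'M[R]_k :=
  B *m g p *m B^T.

(* |det (A|_V)|, the factor by which A : T_pM -> T_qM multiplies the volume of
   the parallelepiped spanned by a basis of V. *)
Definition absdet (p q : M) (A V : 'M[R]_n) : R :=
  Num.sqrt (\det (gram q (row_base V *m A))) /
  Num.sqrt (\det (gram p (row_base V))).

Variables (D : set (R * M)) (phi : R -> M -> M) (L : set M).

Definition uniformly_contracted (E : M -> 'M[R]_n) : Prop :=
  exists C lambda : R, [/\ 0 < C, 0 < lambda &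
    forall x t, L x -> 0 <= t ->
      (opnorm x (phi t x) (dflow D phi t x) (E x) <=
       (C * expR (- (lambda * t)))%:E)%E].

Definition sectionally_expanding (F : M -> 'M[R]_n) : Prop :=
  (exists2 k : nat, (2 <= k)%N & forall x, L x -> \rank (F x) = k) /\
  exists C lambda : R, [/\ 0 < C, 0 < lambda &
    forall x (P : 'M[R]_n), L x -> (P <= F x)%MS -> \rank P = 2%N ->
      forall t, 0 < t ->
        C * expR (lambda * t) < absdet x (phi t x) (dflow D phi t x) P].

Definition hyperbolic_set (X : M -> 'rV[R]_n) : Prop :=
  let EX := fun x => <<X x>>%MS in
  [/\ compact L, invariant_set D phi L &
    exists Es Eu : M -> 'M[R]_n,
      [/\ [/\ continuous_subbundle L Es, continuous_subbundle L EX
            & continuous_subbundle L Eu],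
          [/\ invariant_subbundle D phi L Es, invariant_subbundle D phi L EX
            & invariant_subbundle D phi L Eu],
          forall x, L x -> row_full (Es x + EX x + Eu x)%MS /\
                           mxdirect (Es x + EX x + Eu x)%MS
        & exists K lambda : R, [/\ 0 < K, 0 < lambda &
            forall x t, L x -> 0 <= t ->
              (opnorm x (phi t x) (dflow D phi t x) (Es x) <=
               (K * expR (- (lambda * t)))%:E)%E /\
              (opnorm x (phi (- t) x) (dflow D phi (- t) x) (Eu x) <=
               (K * expR (- (lambda * t)))%:E)%E]]].

End Metric.
End Manifolds.

(* Main.v *)
Require Import Defs.
From HB Require Import structures.
From mathcomp Require Import all_boot all_order all_algebra.
From mathcomp Require Import all_classical all_reals all_analysis.
From mathcomp Require Import ring lra.

Set Implicit Arguments.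
Unset Strict Implicit.
Unset Printing Implicit Defensive.

Import Order.TTheory GRing.Theory Num.Theory.
Import numFieldNormedType.Exports.

Local Open Scope classical_set_scope.
Local Open Scope ring_scope.

(** The field X lies in F: its component along E grows exponentially in
    backward time, while X is bounded on the compact set.  Sectional expansion
    of the planes spanned by X(x) and v in F_x then says that the flow expands
    the part of v orthogonal to X exponentially.  Let theta_x be the linear form
    on F_x giving the component along X.  The pullbacks of theta by DX_{-T}
    differ only through the part orthogonal to X, which is contracted
    backwards, so they converge uniformly, as T tends to infinity, to a
    continuous invariant form a with a(X) = 1.  Its kernel in F is E^u; the
    projections 1 - pi_F, a X and pi_F - a X give the hyperbolic splitting.

    The invariant set misses the boundary, because X points inward there, so
    all derivatives are taken at interior points of charts. *)

(** * Limits of matrices and Jacobians *)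

(** Sectional expansion controls areas, hence vectors of F only modulo X: the orthogonal complement
    of X in F is expanded after projection, but it is not invariant, and an image may acquire a
    component along X that the area does not see. Linear forms avoid a graph construction on
    subspaces. Pulled back from integer times they are Cauchy at a geometric rate, each takes the
    value 1 on X, so the kernel of the limit is automatically transverse to X. On that kernel the
    component along X is bounded by the orthogonal one, so the decay of the latter is enough. A
    second obstacle is that components of vectors at x refer to [chart_at x], which need not depend
    continuously on x. Continuity is therefore always stated after passing to a chart fixed near a
    point q, and identities between derivatives come from the chain rule and the uniqueness of
    derivatives at interior points. The constants come from compactness: bounds of the norm of X
    from both sides, of the projection to F, and of DX_s for each fixed s. *)

Section MatrixLimits.
Variable R : realType.

Lemma normmx_entry m n (A : 'M[R]_(m, n)) i j : `|A i j| <= `|A|.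
Proof.
rewrite [leRHS]/Num.norm /= mx_normrE.
by apply/bigmax_geP; right => /=; exists (i, j).
Qed.

Lemma normmx_le m n (A : 'M[R]_(m, n)) (e : R) :
  0 <= e -> (forall i j, `|A i j| <= e) -> `|A| <= e.
Proof.
move=> e0 Ae; rewrite [leLHS]/Num.norm /= mx_normrE.
by apply/bigmax_leP; split => // -[i j] _; exact: Ae.
Qed.

(** The norm is the largest modulus of an entry, so each entry of the product is a sum of [n] terms.
    With [A] last, the bound reads as a Lipschitz estimate for right multiplication by [B]. *)
Lemma normmx_mul m n p (A : 'M[R]_(m, n)) (B : 'M[R]_(n, p)) :
  `|A *m B| <= n%:R * `|B| * `|A|.
Proof.
apply: normmx_le; first by rewrite !mulr_ge0.
move=> i j; rewrite mxE; apply: le_trans (ler_norm_sum _ _ _) _.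
rewrite -[X in X%:R * _ * _](card_ord n) -mulrA mulr_natl -sumr_const.
by apply: ler_sum => k _; rewrite normrM mulrC ler_pM // normmx_entry.
Qed.

Variables (T : Type) (F : set_system T).
Context {FF : Filter F}.

Lemma cvg_mxP m n (f : T -> 'M[R]_(m, n)) (A : 'M[R]_(m, n)) :
  f @ F --> A <-> forall i j, (fun x => f x i j) @ F --> A i j.
Proof.
split=> [fA i j|fA].
  apply/cvgrPdist_le => e e0; move/cvgrPdist_le: fA => /(_ e e0).
  apply: filterS => x; apply: le_trans.
  by have := normmx_entry (A - f x) i j; rewrite !mxE.
apply/cvgrPdist_le => e e0.
have : \forall x \near F, forall ij : 'I_m * 'I_n, `|A ij.1 ij.2 - f x ij.1 ij.2| <= e.
  apply: filter_forall => -[i j] /=.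
  by have /cvgrPdist_le/(_ e e0) := fA i j.
apply: filterS => x fx; apply: normmx_le; first exact: ltW.
by move=> i j; rewrite !mxE; exact: (fx (i, j)).
Qed.

Lemma cvg_mulmx m n p (f : T -> 'M[R]_(m, n)) (g : T -> 'M[R]_(n, p))
    (A : 'M[R]_(m, n)) (B : 'M[R]_(n, p)) :
  f @ F --> A -> g @ F --> B -> (fun x => f x *m g x) @ F --> A *m B.
Proof.
move=> /cvg_mxP fA /cvg_mxP gB; apply/cvg_mxP => i j.
under eq_cvg do rewrite mxE.
rewrite mxE; apply: cvg_big => [|k _]; first exact: add_continuous.
by apply: cvgM; [exact: fA|exact: gB].
Qed.

Lemma cvg_trmx m n (f : T -> 'M[R]_(m, n)) (A : 'M[R]_(m, n)) :
  f @ F --> A -> (fun x => (f x)^T) @ F --> A^T.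
Proof.
move=> /cvg_mxP fA; apply/cvg_mxP => i j.
by under eq_cvg do rewrite mxE; rewrite mxE; exact: fA.
Qed.

Lemma cvg_det n (f : T -> 'M[R]_n) (A : 'M[R]_n) :
  f @ F --> A -> (fun x => \det (f x)) @ F --> \det A.
Proof.
move=> /cvg_mxP fA; apply: cvg_big => [|s _]; first exact: add_continuous.
apply: cvgM; first exact: cvg_cst.
apply: cvg_big => [|k _]; first exact: mul_continuous.
exact: fA.
Qed.

Lemma near_unitmx n (f : T -> 'M[R]_n) (A : 'M[R]_n) :
  f @ F --> A -> A \in unitmx -> \forall x \near F, f x \in unitmx.
Proof.
move=> /cvg_det fA; rewrite unitmxE unitfE => A0.
have : \forall x \near F, \det (f x) != 0.
  have := @cvgr_neq0 R R _ _ _ _ _ fA A0.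
  by apply.
by apply: filterS => x; rewrite unitmxE unitfE.
Qed.

(** Cramer's formula reduces this to determinants. [invmx] follows that formula only on invertible
    matrices, hence the detour through eventual invertibility of [f x]. *)
Lemma cvg_invmx n (f : T -> 'M[R]_n) (A : 'M[R]_n) :
  f @ F --> A -> A \in unitmx -> (fun x => invmx (f x)) @ F --> invmx A.
Proof.
move=> fA Au; have fu := near_unitmx fA Au; apply/cvg_mxP => i j.
have := fA => /cvg_mxP fAij.
have detA : \det A != 0 by move: Au; rewrite unitmxE unitfE.
rewrite /invmx Au !mxE.
have h : (fun x => (\det (f x))^-1 * cofactor (f x) j i) @ F -->
    (\det A)^-1 * cofactor A j i.
  apply: cvgM; first by apply: cvgV => //; exact: cvg_det.
  apply: cvgM; first exact: cvg_cst.
  by apply: cvg_det; apply/cvg_mxP => k l; under eq_cvg do rewrite !mxE;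
    rewrite !mxE; exact: fAij.
apply: cvg_trans h; apply: near_eq_cvg.
by apply: filterS fu => x fxu; rewrite fxu !mxE.
Qed.

End MatrixLimits.

(** * Derivatives at interior points: uniqueness, chain rule, continuity of Jacobians *)

Section Derivatives.
Variable R : realType.

Lemma near_within_setT (T : Type) (F : set_system T) (FF : Filter F) (P : set T) :
  (\forall x \near within setT F, P x) = (\forall x \near F, P x).
Proof.
by rewrite near_withinE propeqE; split; apply: filterS => x //; exact.
Qed.

Lemma near_dist (V : normedModType R) (x : V) (e : R) :
  0 < e -> \forall z \near x, `|x - z| <= e.
Proof. by move=> e0; have /cvgrPdist_le/(_ e e0) := (@cvg_id _ (nbhs x)). Qed.

Lemma has_deriv_within_nbhs (V W : normedModType R) (S : set V) (f : V -> W) x L :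
  nbhs x S -> has_deriv_within S f x L -> has_deriv_within setT f x L.
Proof.
move=> Sx fL e e0; rewrite near_within_setT; have := fL e e0; rewrite near_withinE => h.
by apply: filterS2 Sx h => z Sz; exact.
Qed.

Lemma has_deriv_within_sub (V W : normedModType R) (S : set V) (f : V -> W) x L :
  has_deriv_within setT f x L -> has_deriv_within S f x L.
Proof.
move=> fL e e0; have := fL e e0; rewrite near_within_setT near_withinE.
by apply: filterS => z.
Qed.

Lemma has_deriv_near_eq (V W : normedModType R) (f h : V -> W) x L :
  (\forall z \near x, f z = h z) ->
  has_deriv_within setT f x L -> has_deriv_within setT h x L.
Proof.
move=> fh fL e e0; have := fL e e0; rewrite !near_within_setT.
have fhx := nbhs_singleton fh.
by apply: filterS2 fh => z ->; rewrite fhx.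
Qed.

Lemma has_deriv_cvg (V W : normedModType R) (f : V -> W) x L (K : R) :
  (forall v, `|L v| <= K * `|v|) -> has_deriv_within setT f x L ->
  f z @[z --> x] --> f x.
Proof.
move=> LK fL; apply/cvgrPdist_le => e e0.
pose d := e / (`|K| + 1).
have K0 : 0 < `|K| + 1 by rewrite ltr_wpDl.
have d0 : 0 < d by rewrite divr_gt0.
have := fL 1 ltr01; rewrite near_within_setT => h.
have zx : \forall z \near x, `|x - z| <= d by exact: near_dist.
apply: filterS2 zx h => z zx h; rewrite distrC in zx.
rewrite distrC -[f z - f x](subrK (L (z - x))).
apply: le_trans (ler_normD _ _) _; apply: le_trans (lerD h (LK _)) _.
rewrite -mulrDl addrC.
apply: (@le_trans _ _ ((`|K| + 1) * d)); last by rewrite mulrC divfK ?gt_eqF.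
apply: (@le_trans _ _ ((`|K| + 1) * `|z - x|)).
  by rewrite ler_wpM2r // lerD2r ler_norm.
by rewrite ler_wpM2l // ltW.
Qed.

Lemma has_deriv_comp (V : normedModType R) m n (f : V -> 'rV[R]_m)
    (h : 'rV[R]_m -> 'rV[R]_n) x L (K : R) A :
  (forall v, `|L v| <= K * `|v|) -> has_deriv_within setT f x L ->
  has_deriv_within setT h (f x) (fun v => v *m A) ->
  has_deriv_within setT (h \o f) x (fun v => L v *m A).
Proof.
move=> LK fL hA e e0.
(* [k] will be a Lipschitz constant of [f] at [x], thanks to the 1 in [e2], and [a] is one for
   multiplication by [A]. The two halves of [e] pay for the error of [h] and for the error of [f]
   transported by [A]. *)
pose k := `|K| + 1; have k0 : 0 < k by rewrite ltr_wpDl.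
pose a := m%:R * `|A| + 1; have a0 : 0 < a by rewrite ltr_wpDl // mulr_ge0.
pose e1 := e / (2 * k); pose e2 := Num.min 1 (e / (2 * a)).
have e10 : 0 < e1 by rewrite divr_gt0 // mulr_gt0.
have e20 : 0 < e2 by rewrite lt_min ltr01 divr_gt0 // mulr_gt0.
have := hA e1 e10; have := fL e2 e20; rewrite !near_within_setT => fx hx.
have hfx := has_deriv_cvg LK fL hx.
apply: filterS2 fx hfx => z fz hfz /=.
have fzx : `|f z - f x| <= k * `|z - x|.
  rewrite -[f z - f x](subrK (L (z - x))).
  apply: le_trans (ler_normD _ _) _; apply: le_trans (lerD fz (LK _)) _.
  rewrite -mulrDl ler_wpM2r // addrC /k lerD ?ler_norm //.
  by rewrite ge_min lexx.
have -> : h (f z) - h (f x) - L (z - x) *m A =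
    (h (f z) - h (f x) - (f z - f x) *m A) + (f z - f x - L (z - x)) *m A.
  by rewrite (mulmxBl (f z - f x)) addrA subrK.
apply: le_trans (ler_normD _ _) _.
rewrite [e](splitr e) mulrDl lerD //.
  apply: le_trans hfz _; rewrite {1}/e1.
  apply: le_trans (ler_wpM2l _ fzx) _; first exact: ltW.
  rewrite mulrA ler_wpM2r // invfM mulrA mulfVK ?gt_eqF //.
apply: le_trans (normmx_mul _ _) _.
apply: (@le_trans _ _ (a * `|f z - f x - L (z - x)|)).
  by rewrite ler_wpM2r // lerDl.
apply: le_trans (ler_wpM2l _ fz) _; first exact: ltW.
rewrite mulrA ler_wpM2r //.
apply: (@le_trans _ _ (a * (e / (2 * a)))).
  by rewrite ler_wpM2l ?ge_min ?lexx ?orbT // ltW.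
have a0' : a != 0 by rewrite gt_eqF.
have -> : a * (e / (2 * a)) = e / 2 by field.
by [].
Qed.

Lemma has_deriv_unique (V W : normedModType R) (f : V -> W) x L1 L2 :
  (forall (s : R) v, L1 (s *: v) = s *: L1 v) ->
  (forall (s : R) v, L2 (s *: v) = s *: L2 v) ->
  has_deriv_within setT f x L1 -> has_deriv_within setT f x L2 ->
  forall v, L1 v = L2 v.
Proof.
move=> L1Z L2Z f1 f2 v; apply/eqP; rewrite -subr_eq0 -normr_le0.
apply/ler_addgt0Pl => e e0; rewrite addr0.
have [->|v0] := eqVneq v 0.
  have := L1Z 0 0; have := L2Z 0 0; rewrite !scale0r => -> ->.
  by rewrite subrr normr0 ltW.
have nv : 0 < `|v| by rewrite normr_gt0.
(* The two errors add up to 2 d |z - x|, which is s e at z = x + s v; homogeneity then cancels s. *)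
pose d := e / (2 * `|v|); have d0 : 0 < d by rewrite divr_gt0 // mulr_gt0.
have := f1 d d0; have := f2 d d0; rewrite !near_within_setT => g2 g1.
have : \forall z \near x, `|L1 (z - x) - L2 (z - x)| <= 2 * d * `|z - x|.
  apply: filterS2 g1 g2 => z h1 h2.
  have -> : L1 (z - x) - L2 (z - x) =
     (f z - f x - L2 (z - x)) - (f z - f x - L1 (z - x)).
    by rewrite [X in _ = _ + X]opprB [RHS]addrC addrA subrK.
  apply: le_trans (ler_normB _ _) _.
  by rewrite [2]mulr2n !mulrDl mul1r lerD.
move=> /nbhs_ballP [r /= r0 h].
pose s := r / (2 * `|v|); have s0 : 0 < s by rewrite divr_gt0 // mulr_gt0.
have := h (x + s *: v).
rewrite -ball_normE /ball_ /= opprD addrA subrr sub0r normrN normrZ (gtr0_norm s0).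
have sv : s * `|v| < r.
  rewrite /s invfM mulrA mulfVK ?gt_eqF // ltr_pdivrMr // ltr_pMr //.
  by rewrite ltr1n.
have -> : x + s *: v - x = s *: v by rewrite addrAC subrr add0r.
move=> /(_ sv); rewrite L1Z L2Z -scalerBr (normrZ s) (normrZ s v) (gtr0_norm s0).
rewrite mulrCA ler_pM2l // /d.
have nv' : `|v| != 0 by rewrite gt_eqF.
by have -> : 2 * (e / (2 * `|v|)) * `|v| = e by field.
Qed.

Lemma normmx_mul_bound m n (A : 'M[R]_(m, n)) (v : 'rV[R]_m) :
  `|v *m A| <= m%:R * `|A| * `|v|.
Proof. exact: normmx_mul. Qed.

(** [jac_within] picks some derivative by choice; at an interior point of [S] uniqueness forces the
    pick. *)
Lemma jac_withinE m n S (f : 'rV[R]_m -> 'rV[R]_n) x A :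
  nbhs x S -> has_deriv_within setT f x (fun v => v *m A) ->
  jac_within S f x = A.
Proof.
move=> Sx fA; rewrite /jac_within.
have : has_deriv_within S f x (fun v => v *m A) by exact: has_deriv_within_sub.
move=> /(@getI _ [set A | has_deriv_within S f x (fun v => v *m A)]) /=.
set B := get _ => /(has_deriv_within_nbhs Sx) fB.
apply/row_matrixP => i; rewrite !rowE.
by apply: (has_deriv_unique _ _ fB fA) => s v; rewrite scalemxAl.
Qed.

Lemma differentiable_has_deriv (V W : normedModType R) (f : V -> W) x :
  differentiable f x -> has_deriv_within setT f x ('d f x).
Proof.
move=> /diffE fx e e0; rewrite near_within_setT.
near=> z.
rewrite {1}(fx z) lim_id // -addrA -opprD addrAC subrr add0r.
near: z; exact: littleoP.
Unshelve. all: by end_near. Qed.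

(* [z] is an affine embedding with linear part [i]: it is either the identity
   or the inclusion of a time slice into R x R^m. *)
Lemma Ck1_slice_jac (V : normedModType R) m n (U : set V) (h : V -> 'rV[R]_n)
    (z : 'rV[R]_m -> V) (i : {linear 'rV[R]_m -> V}) (y0 : 'rV[R]_m) :
  open U -> Ck 1 U h -> U (z y0) ->
  (forall y y', z y' - z y = i (y' - y)) -> (forall v, `|i v| <= `|v|) ->
  exists J : 'rV[R]_m -> 'M[R]_(m, n),
    (\forall y \near y0,
       has_deriv_within setT (h \o z) y (fun v => v *m J y)) /\
    J y @[y --> y0] --> J y0.
Proof.
move=> oU [dh ch] Uz zi i1.
have zc y : z y' @[y' --> y] --> z y.
  apply/(@cvgrPdist_le _ _ _ _ (nbhs_filter y)) => e e0.
  have := near_dist y e0.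
  by apply: filterS => y' /=; apply: le_trans; rewrite zi i1.
exists (fun y => \matrix_(k < m) 'D_(i (delta_mx 0 k)) h (z y)); split; last first.
  apply/(cvg_mxP (FF := nbhs_filter y0)) => k j.
  have : 'D_(i (delta_mx 0 k)) h (z y) @[y --> y0] --> 'D_(i (delta_mx 0 k)) h (z y0).
    apply: (@cvg_comp _ _ _ z ('D_(i (delta_mx 0 k)) h) _ (nbhs (z y0))).
      exact: zc.
    exact: (ch (i (delta_mx 0 k)) (z y0) Uz).
  move=> /(cvg_mxP (FF := nbhs_filter y0)) /(_ 0 j) hc.
  by under eq_cvg do rewrite mxE; rewrite mxE.
have : \forall y \near y0, U (z y) by apply: zc; exact: open_nbhs_nbhs.
apply: filterS => y Uy.
have dhy := dh _ Uy.
have lin v : 'd h (z y) (i v) = v *m \matrix_k 'D_(i (delta_mx 0 k)) h (z y).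
  rewrite {1}(row_sum_delta v) !linear_sum mulmx_sum_row.
  by apply: eq_bigr => k _; rewrite !linearZ rowK deriveE.
move=> e e0; have := differentiable_has_deriv dhy e0.
rewrite !near_within_setT => /(zc y); apply: (@filterS _ _ (nbhs_filter y)) => y' /=.
rewrite zi lin => /le_trans; apply; rewrite ler_wpM2l //; exact: ltW.
Qed.

End Derivatives.

Lemma cvg_within_nbhs (T : topologicalType) (U : Type) (f : T -> U) (S : set T) (x : T)
    (G : set_system U) :
  nbhs x S -> f y @[y --> within S (nbhs x)] --> G -> f y @[y --> x] --> G.
Proof.
move=> Sx h A /h hA.
by apply: (@filterS2 _ _ (nbhs_filter x) _ _ _ _ Sx hA) => y Sy; exact.
Qed.

(** * Charts and the derivative of the flow *)

Section C1Slice.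
Variable R : realType.

(** The function agrees with its C^1 extension only on [S]. As [S] is a neighbourhood of [z y0],
    they agree around every nearby point, so the derivatives of the extension are derivatives of
    [f]. *)
Lemma C1_slice_jac (V : normedModType R) m n (S : set V) (f : V -> 'rV[R]_n)
    (z : 'rV[R]_m -> V) (i : {linear 'rV[R]_m -> V}) (y0 : 'rV[R]_m) :
  C1_on S f -> nbhs (z y0) S ->
  (forall y y', z y' - z y = i (y' - y)) -> (forall v, `|i v| <= `|v|) ->
  exists J : 'rV[R]_m -> 'M[R]_(m, n),
    (\forall y \near y0, nbhs y [set y | S (z y)] /\
       has_deriv_within setT (f \o z) y (fun v => v *m J y)) /\
    J y @[y --> y0] --> J y0.
Proof.
move=> fC1 Sz zi i1.
have zc y : z y' @[y' --> y] --> z y.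
  apply/(@cvgrPdist_le _ _ _ _ (nbhs_filter y)) => e e0.
  have := near_dist y e0.
  by apply: filterS => y' /=; apply: le_trans; rewrite zi i1.
have [U [h [oU Uz hC1 fh]]] := fC1 _ (nbhs_singleton Sz).
have [J [Jd Jc]] := Ck1_slice_jac oU hC1 Uz zi i1.
exists J; split => //.
have SU : nbhs (z y0) (nbhs^~ (S `&` U)).
  apply: nbhs_interior; apply: filterI => //; exact: open_nbhs_nbhs.
apply: (@filterS2 _ _ (nbhs_filter y0) _ _ _ _ Jd (zc y0 _ SU)) => y hd /(zc y) SUy.
split; first by apply: (@filterS _ _ (nbhs_filter y) _ _ _ SUy) => y' [].
apply: has_deriv_near_eq hd.
by apply: (@filterS _ _ (nbhs_filter y) _ _ _ SUy) => y' [Sy Uy] /=; rewrite fh.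
Qed.

End C1Slice.

Section Charts.
Variables (R : realType) (n : nat) (M : manifold R n).
Implicit Types (a b c : chart R n M) (p q x : M).

(** The target of a chart is only relatively open in a half-space; here it must contain a full
    neighbourhood, so that [jac_within] is determined. *)
Definition inner a p := csrc a p /\ nbhs (a p) (ctgt a).

Definition is_tangent a b (psi : M -> M) p (A : 'M[R]_n) :=
  has_deriv_within setT (fun y => b (psi (cinv a y))) (a p) (fun v => v *m A).

Lemma coord_cvg a p : csrc a p -> a x @[x --> p] --> a p.
Proof.
move=> ap; have /subspace_continuousP/(_ p ap) := @Defs.coord_continuous _ _ _ a.
move.
by apply: cvg_within_nbhs; exact: (open_nbhs_nbhs (conj (csrc_open a) ap)).
Qed.

Lemma cinv_cvg a p : inner a p -> cinv a y @[y --> a p] --> p.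
Proof.
move=> [ap ia].
have [ta ka] := coordK ap.
have : cinv a y @[y --> within (ctgt a) (nbhs (a p))] --> cinv a (a p).
  by have /subspace_continuousP := @cinv_continuous _ _ _ a; exact.
rewrite ka; exact: cvg_within_nbhs.
Qed.

Lemma inner_near a p : inner a p -> \forall x \near p, inner a x.
Proof.
move=> [ap ia].
have := coord_cvg ap (nbhs_interior ia).
apply: filterS2 (open_nbhs_nbhs (conj (csrc_open a) ap)) => x ax h.
by split.
Qed.

Lemma tangent_comp a b c psi chi p A B :
  inner a p -> csrc b (psi p) -> psi x @[x --> p] --> psi p ->
  is_tangent a b psi p A -> is_tangent b c chi (psi p) B ->
  is_tangent a c (chi \o psi) p (A *m B).
Proof.
move=> ia bp psic hA hB; rewrite /is_tangent.
have [_ ka] := coordK ia.1.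
pose f y := b (psi (cinv a y)); pose h y := c (chi (cinv b y)).
have fp : f (a p) = b (psi p) by rewrite /f ka.
have := @has_deriv_comp _ _ _ _ f h (a p) _ _ B (normmx_mul_bound A) hA.
rewrite fp => /(_ hB) d.
rewrite (_ : mulmx^~ (A *m B) = fun v : 'rV[R]_n => v *m A *m B); last first.
  by apply/funext => v; rewrite mulmxA.
apply: has_deriv_near_eq d.
have bo := psic _ (open_nbhs_nbhs (conj (csrc_open b) bp)).
have := cinv_cvg ia bo.
apply: (@filterS _ _ (nbhs_filter (a p))) => y /= by'.
by rewrite /h /f /= (coordK by').2.
Qed.

Lemma tangent_unique a b psi p A B :
  is_tangent a b psi p A -> is_tangent a b psi p B -> A = B.
Proof.
move=> hA hB; apply/row_matrixP => i; rewrite !rowE.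
by apply: (has_deriv_unique _ _ hA hB) => s v; rewrite scalemxAl.
Qed.

(** The transition map has a continuous Jacobian around [a p], and [change_coord] recovers it at
    every nearby point, not just at [p]. *)
Lemma change_coord_near p0 q0 p :
  let a := chart_at p0 in let b := chart_at q0 in inner a p -> csrc b p ->
  (\forall x \near p, is_tangent a b id x (change_coord a b x)) /\
  change_coord a b x @[x --> p] --> change_coord a b p.
Proof.
move=> a b ia bp.
set S := [set y | ctgt a y /\ csrc b (cinv a y)].
have [_ ka] := coordK ia.1.
have Sap : nbhs (a p) S.
  apply: (@filterI _ _ (nbhs_filter (a p))); first exact: ia.2.
  apply: (cinv_cvg ia); exact: (open_nbhs_nbhs (conj (csrc_open b) bp)).
have fC1 : C1_on S (fun y => b (cinv a y)).
  move=> y Sy; have [U [h [oU Uy hC fh]]] := @transition_smooth _ _ M p0 q0 y Sy.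
  by exists U, h; split.
have [|v|J [Jd Jc]] := @C1_slice_jac _ _ _ _ S (fun y => b (cinv a y)) id idfun (a p) fC1 Sap.
- by [].
- by [].
have key : \forall x \near p, change_coord a b x = J (a x) /\
    is_tangent a b id x (J (a x)).
  apply: (@filterS _ _ (nbhs_filter p) _ _ _ (coord_cvg ia.1 Jd)) => x [Sx hx].
  split => //.
  exact: jac_withinE.
have Jp := (nbhs_singleton key).1.
split; first by apply: filterS key => x [->].
rewrite Jp; apply: (@cvg_trans _ (J (a x) @[x --> p])).
  by apply: near_eq_cvg; apply: filterS key => x [->].
by move=> A /Jc; exact: (coord_cvg ia.1).
Qed.

Lemma change_coordP p0 q0 p :
  let a := chart_at p0 in let b := chart_at q0 in inner a p -> csrc b p ->
  is_tangent a b id p (change_coord a b p).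
Proof.
by move=> a b ia bp; have [/nbhs_singleton] := change_coord_near ia bp.
Qed.

Lemma change_coordM p0 q0 r0 p :
  let a := chart_at p0 in let b := chart_at q0 in let c := chart_at r0 in
  inner a p -> inner b p -> csrc c p ->
  change_coord a b p *m change_coord b c p = change_coord a c p.
Proof.
move=> a b c ia ib cp.
apply: (@tangent_unique a c id p); last exact: change_coordP.
apply: (@tangent_comp a b c id id p) => //; first exact: ib.1.
- by apply: change_coordP => //; exact: ib.1.
- exact: change_coordP.
Qed.

Lemma change_coord_id p0 p :
  let a := chart_at p0 in inner a p -> change_coord a a p = 1%:M.
Proof.
move=> a ia; apply: (@tangent_unique a a id p).
  by apply: change_coordP => //; exact: ia.1.
move=> e e0; rewrite (@near_within_setT _ _ (nbhs_filter (a p))).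
have [ta ka] := coordK ia.1.
apply: (@filterS _ _ (nbhs_filter (a p)) _ _ _ ia.2) => y ty.
by rewrite (cinvK ty).2 ka mulmx1 subrr normr0 mulr_ge0 // ltW.
Qed.

(** Only the coordinate of index 0 is constrained by the half-space. It is nonnegative at [p] and
    nonzero off the boundary, hence positive nearby. *)
Lemma chart_at_inner p : ~ boundary p -> inner (chart_at p) p.
Proof.
move=> nb; have sp := chart_atP p; split => //.
have [tp _] := coordK sp; have [V oV ctgtE] := ctgt_open (chart_at p).
move: tp; rewrite ctgtE => -[Vp Hp].
apply: (@filterI _ _ (nbhs_filter (chart_at p p))).
  exact: open_nbhs_nbhs.
rewrite /half_space /=.
suff : nbhs (chart_at p p)
    [set y : 'rV[R]_n | forall i : 'I_n, i = 0%N :> nat -> 0 <= y 0 i] by [].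
apply: (@filter_forall _ _ _ _ (nbhs_filter (chart_at p p))) => i.
have [i0|i0] := pselect (i = 0%N :> nat); last first.
  by apply: (@filterE _ _ (nbhs_filter _)) => y /i0.
have pos : 0 < chart_at p p 0 i.
  rewrite lt_neqAle (Hp i i0) andbT eq_sym; apply/eqP => h; apply: nb.
  by exists i.
have c : (fun y : 'rV[R]_n => y 0 i) @ nbhs (chart_at p p) --> chart_at p p 0 i.
  exact: coord_continuous.
have := @cvgr_gt _ _ _ (nbhs_filter _) _ _ c 0 pos.
by apply: (@filterS _ _ (nbhs_filter _)) => y /ltW.
Qed.

End Charts.

Lemma nbhs_section (T U : topologicalType) (t : T) (x : U) (A : set (T * U)) :
  nbhs (t, x) A -> nbhs x [set y | A (t, y)].
Proof.
move=> [[B C] /= [Bt Cx] BC]; apply: filterS Cx => y Cy.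
by apply: BC; split => //=; exact: nbhs_singleton.
Qed.

Definition time_slice (R : realType) m (v : 'rV[R]_m) : (R^o * 'rV[R]_m)%type :=
  (0, v).

Lemma time_slice_linear (R : realType) m : linear (@time_slice R m).
Proof. by move=> r u v; rewrite /time_slice; congr (_, _); rewrite /= ?scaler0 ?addr0. Qed.

HB.instance Definition _ (R : realType) m :=
  GRing.isLinear.Build R 'rV[R]_m (R^o * 'rV[R]_m)%type _ (@time_slice R m)
    (@time_slice_linear R m).

(** * The flow and its derivative along the invariant set *)

Section Flow.
Variables (R : realType) (n : nat) (M : manifold R n) (X : M -> 'rV[R]_n)
  (D : set (R * M)) (phi : R -> M -> M) (Lam : set M).
Hypotheses (hXin : inwardly_transverse X) (hphi : is_flow X D phi)
  (hLinv : invariant_set D phi Lam).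
Implicit Types (p q x : M) (s t : R).

Lemma invariant_dom t x : Lam x -> D (t, x).
Proof. by have [h _] := hLinv t; exact: h. Qed.

Lemma invariant_flow t x : Lam x -> Lam (phi t x).
Proof. by move=> Lx; have [_ <-] := hLinv t; exists x. Qed.

Lemma flow_domT x : Lam x -> [set t | D (t, x)] = setT.
Proof. by move=> Lx; apply/seteqP; split => // t _; exact: invariant_dom. Qed.

Lemma flow_curve x : Lam x -> integral_curve X setT (phi ^~ x).
Proof. by move=> Lx; rewrite -(flow_domT Lx); exact: (flow_integral hphi x). Qed.

Lemma flow_curve_cvg x t : Lam x -> phi s x @[s --> t] --> phi t x.
Proof.
move=> /flow_curve [/subspace_continuousP/(_ t I) + _].
by apply: cvg_within_nbhs; exact: filterT.
Qed.

(* An orbit that starts on the boundary with an inward velocity leaves the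
   half-space in negative time. *)
Lemma invariant_interior x : Lam x -> ~ boundary x.
Proof.
move=> Lx bx; have := hXin bx; case: bx => i i0 xi0 /(_ i i0) Xi.
have [_ /(_ 0 I)] := flow_curve Lx.
(* With half the inward speed as tolerance, the coordinate of index 0 at time -r/2 is at most minus
   a quarter of r times that speed, so it is negative. *)
rewrite (flow0 hphi) => /(_ (X x 0 i / 2)).
rewrite divr_gt0 // => /(_ isT); rewrite near_within_setT => near1.
have near2 := flow_curve_cvg (t := 0) Lx.
rewrite (flow0 hphi) in near2.
have := near2 _ (open_nbhs_nbhs (conj (csrc_open (chart_at x)) (chart_atP x))).
move=> {}near2.
have [r /= r0 h] := (nbhs_ballP (0 : R) _).1 (filterI near1 near2).
have br : ball (0 : R) r (- (r / 2)).
  rewrite -ball_normE /ball_ /= opprK add0r ger0_norm ?divr_ge0 ?ltW //.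
  by rewrite ltr_pdivrMr // ltr_pMr // ltr1n.
have [] := h _ br; rewrite subr0 => h1 h2.
have [cp _] := coordK h2.
have [V _ ctgtE] := ctgt_open (chart_at x).
move: cp; rewrite ctgtE => -[_ /(_ i i0) cp].
have := le_trans (normmx_entry _ 0 i) h1.
rewrite !mxE (flow0 hphi) xi0 subr0 normrN (gtr0_norm (_ : 0 < r / 2)); last by rewrite divr_gt0.
move=> /(le_trans (ler_norm _)).
have : 0 < r * X x 0 i by rewrite mulr_gt0.
nra.
Qed.

Lemma invariant_inner x : Lam x -> inner (chart_at x) x.
Proof. by move=> /invariant_interior; exact: chart_at_inner. Qed.

Lemma flow_nbhs t x : Lam x -> nbhs (t, x) D.
Proof.
move=> Lx; apply: (flow_dom_nbhs hphi (invariant_dom t Lx)).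
by apply: invariant_interior; exact: invariant_flow.
Qed.

Lemma flow_cvg2 t x : Lam x ->
  phi z.1 z.2 @[z --> (t, x)] --> phi t x.
Proof.
move=> Lx; have Dx := invariant_dom t Lx.
have := flow_continuous hphi => /subspace_continuousP/(_ (t, x) Dx).
by apply: cvg_within_nbhs; exact: flow_nbhs.
Qed.

Lemma flow_cvg t x : Lam x -> phi t y @[y --> x] --> phi t x.
Proof.
move=> Lx A /(flow_cvg2 (t := t) Lx) [[B C] /= [Bt Cx] BC].
by apply: filterS Cx => y Cy; apply: (BC (t, y)); split => //; exact: nbhs_singleton.
Qed.

(** The shifted curve is an integral curve through [phi t x], so uniqueness applies. The hypotheses
    are on the domain rather than on [Lam] because [dflowD] needs the identity on a whole
    neighbourhood of a point of [Lam]. *)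
Lemma flowD s t x : D (t, x) -> D (t + s, x) ->
  phi s (phi t x) = phi (t + s) x.
Proof.
move=> Dt Ds; apply/esym; set J := [set u | D (t + u, x)].
have c u : t + z @[z --> u] --> t + u.
  by apply: cvgD; [exact: cvg_cst|exact: cvg_id].
have [cont der] := flow_integral hphi x.
apply: (@flow_unique _ _ _ _ _ _ hphi (phi t x) J (fun s => phi (t + s) x)) => //.
- move=> u v Ju Jv w /andP[uw wv].
  by apply: (flow_interval hphi Ju Jv); rewrite !lerD2l uw wv.
- by rewrite /J /= addr0.
- by rewrite addr0.
split.
  apply/subspace_continuousP => u Ju A hA.
  exact: (c u _ ((subspace_continuousP _ _).1 cont (t + u) Ju A hA)).
move=> u Ju e e0; have h := der (t + u) Ju e e0.
apply: (@filterS _ _ (nbhs_filter u) _ _ _ (c u _ h)) => z /=.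
by rewrite opprD addrACA subrr add0r.
Qed.

(** The charts at [p] and [phi t p] stay fixed while x moves, so the Jacobian is continuous in x;
    [dflow] changes its charts with the point. *)
Lemma flow_tangent_near t p : Lam p ->
  let a := chart_at p in let b := chart_at (phi t p) in
  exists J : M -> 'M[R]_n,
    [/\ \forall x \near p, is_tangent a b (phi t) x (J x),
        J x @[x --> p] --> J p & J p = dflow D phi t p].
Proof.
move=> Lp a b; have ia := invariant_inner Lp.
have [_ ka] := coordK ia.1.
pose S := [set z : (R^o * 'rV[R]_n)%type |
             [/\ ctgt a z.2, D (z.1, cinv a z.2)
               & csrc b (phi z.1 (cinv a z.2))]].
have cz : (fun z : R^o * 'rV[R]_n => (z.1, cinv a z.2)) z @[z --> (t : R^o, a p)] -->
    (t, p).
  move=> A [[B C] /= [Bt Cp] BC].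
  exists (B, cinv a @^-1` C) => /=; first by split => //; exact: cinv_cvg ia _ Cp.
  by move=> [s y] /= [Bs Cy]; exact: BC.
have Sz : nbhs (t : R^o, a p) S.
  have h1 := cz _ (flow_nbhs t Lp).
  have h2 := cz _ (flow_cvg2 (t := t) Lp
    (open_nbhs_nbhs (conj (csrc_open b) (chart_atP (phi t p))))).
  have h3 : nbhs (t : R^o, a p) [set z | ctgt a z.2].
    by exists (setT, ctgt a) => [|[s y] []//] /=; split; [exact: filterT|exact: ia.2].
  by apply: (@filterS3 _ _ (nbhs_filter (t : R^o, a p)) _ _ _ _ _ h1 h2 h3) => z.
have zi (y y' : 'rV[R]_n) : (t : R^o, y') - (t : R^o, y) = time_slice (y' - y).
  by rewrite /time_slice -[LHS]/(t - t, y' - y) subrr.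
have i1 (v : 'rV[R]_n) : `|time_slice v| <= `|v|.
  by rewrite prod_normE /= normr0 max_r.
have [J [Jd Jc]] := @C1_slice_jac _ _ n n S (fun z => b (phi z.1 (cinv a z.2)))
  (pair (t : R^o)) (@time_slice R n) (a p) (@flow_C1 _ _ _ _ _ _ hphi p (phi t p)) Sz zi i1.
exists (J \o a); split.
- by apply: (@filterS _ _ (nbhs_filter p) _ _ _ (coord_cvg ia.1 Jd)) => x [].
- by move=> A /Jc; exact: (coord_cvg ia.1).
apply/esym; have [Sy hJ] := nbhs_singleton Jd; apply: jac_withinE hJ.
by apply: (@filterS _ _ (nbhs_filter (a p)) _ _ _ Sy) => y [].
Qed.

Lemma dflowP t x : Lam x ->
  is_tangent (chart_at x) (chart_at (phi t x)) (phi t) x (dflow D phi t x).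
Proof.
by move=> Lx; have [J [/nbhs_singleton + _ <-]] := flow_tangent_near t Lx.
Qed.

Lemma dflow0 x : Lam x -> dflow D phi 0 x = 1%:M.
Proof.
move=> Lx; have ix := invariant_inner Lx; have := dflowP 0 Lx.
rewrite (flow0 hphi) => h; apply: tangent_unique h _.
rewrite -(change_coord_id (p0 := x) ix).
have -> : phi 0 = id by apply/funext => y; exact: (flow0 hphi).
by apply: change_coordP => //; exact: ix.1.
Qed.

Lemma dflowD s t x : Lam x ->
  dflow D phi t x *m dflow D phi s (phi t x) = dflow D phi (t + s) x.
Proof.
move=> Lx; have Ly := invariant_flow t Lx; have ix := invariant_inner Lx.
have h := tangent_comp ix (chart_atP (phi t x)) (flow_cvg (t := t) Lx)
  (dflowP t Lx) (dflowP s Ly).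
have dts : phi s (phi t x) = phi (t + s) x by apply: flowD; exact: invariant_dom.
have h' : is_tangent (chart_at x) (chart_at (phi s (phi t x))) (phi (t + s)) x
    (dflow D phi (t + s) x) by rewrite dts; exact: dflowP.
apply: tangent_unique h _; apply: has_deriv_near_eq h'.
have near1 := cinv_cvg ix (nbhs_section (flow_nbhs t Lx)).
have near2 := cinv_cvg ix (nbhs_section (flow_nbhs (t + s) Lx)).
apply: (@filterS2 _ _ (nbhs_filter (chart_at x x)) _ _ _ _ near1 near2) => y D1 D2.
by rewrite /= (flowD D1 D2).
Qed.

(** Both sides are the velocity at time 0 of the curve sending s to X_s(X_t(x)) = X_t(X_s(x)). *)
Lemma X_dflow t x : Lam x -> X x *m dflow D phi t x = X (phi t x).
Proof.
move=> Lx; have Ly := invariant_flow t Lx.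
have [_ /(_ 0 I)] := flow_curve Lx; rewrite !(flow0 hphi) => hx.
have [_ /(_ 0 I)] := flow_curve Ly; rewrite !(flow0 hphi) => hy.
have ix := invariant_inner Lx.
have [_ ka] := coordK ix.1.
pose b := chart_at (phi t x).
pose f (u : R^o) := chart_at x (phi u x).
pose h y := b (phi t (cinv (chart_at x) y)).
have fh : has_deriv_within setT h (f 0) (fun v => v *m dflow D phi t x).
  by rewrite /f (flow0 hphi); exact: dflowP.
have bd (u : R^o) : `|(u : R) *: X x| <= `|X x| * `|u| by rewrite normrZ mulrC.
have hc := has_deriv_comp bd hx fh.
have hc' : has_deriv_within setT (fun s : R^o => b (phi s (phi t x))) 0
    (fun u => (u *: X x) *m dflow D phi t x).
  apply: has_deriv_near_eq hc.
  have := flow_curve_cvg (t := 0) Lx.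
  rewrite (flow0 hphi) => /(_ _ (open_nbhs_nbhs
    (conj (csrc_open (chart_at x)) (chart_atP x)))).
  apply: (@filterS _ _ (nbhs_filter (0 : R^o))) => u /= cu.
  rewrite /h /f (coordK cu).2 !flowD; [|exact: invariant_dom..].
  by rewrite addrC.
suff : (1 : R) *: X x *m dflow D phi t x = (1 : R) *: X (phi t x).
  by rewrite !scale1r.
apply: (has_deriv_unique _ _ hc' hy 1) => r u; last by rewrite scalerA.
by rewrite scalemxAl scalerA.
Qed.

(** The coordinate changes turn [dflow] into the Jacobian in the fixed charts at [p] and [phi t p].
    The limit is taken along [Lam], where each point is inner to its own chart. *)
Lemma dflow_cvg t p : Lam p ->
  change_coord (chart_at p) (chart_at x) x *m dflow D phi t x *m
    change_coord (chart_at (phi t x)) (chart_at (phi t p)) (phi t x)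
  @[x --> within Lam (nbhs p)] --> dflow D phi t p.
Proof.
move=> Lp; have [J [Jt Jc Jp]] := flow_tangent_near t Lp.
have ip := invariant_inner Lp; have iq := invariant_inner (invariant_flow t Lp).
have near1 : \forall x \near within Lam (nbhs p),
    J x = change_coord (chart_at p) (chart_at x) x *m dflow D phi t x *m
    change_coord (chart_at (phi t x)) (chart_at (phi t p)) (phi t x).
  rewrite near_withinE.
  have n1 := inner_near ip; have n2 := flow_cvg (t := t) Lp (inner_near iq).
  apply: (@filterS3 _ _ (nbhs_filter p) _ _ _ _ _ Jt n1 n2) => x hJ ix iy Lx.
  apply: tangent_unique hJ _.
  have t1 := change_coordP (p0 := p) (q0 := x) ix (chart_atP x).
  have cx : id y @[y --> x] --> x by [].
  have t2 := tangent_comp ix (chart_atP x) cx t1 (dflowP t Lx).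
  have iy' := invariant_inner (invariant_flow t Lx).
  have t3 := change_coordP (p0 := phi t x) (q0 := phi t p) iy' iy.1.
  have cy : (phi t \o id) y @[y --> x] --> phi t x by exact: flow_cvg.
  exact: (tangent_comp ix (chart_atP (phi t x)) cy t2 t3).
rewrite -Jp; apply: (@cvg_trans _ (J x @[x --> within Lam (nbhs p)])).
  by apply: near_eq_cvg; apply: filterS near1 => x ->.
exact: cvg_within_filter.
Qed.

End Flow.

(** * Norms and angles on the tangent spaces *)

Lemma det_mx2 (R : comNzRingType) (A : 'M[R]_(1 + 1)) :
  \det A = A (lshift 1 0) (lshift 1 0) * A (rshift 1 0) (rshift 1 0)
         - A (lshift 1 0) (rshift 1 0) * A (rshift 1 0) (lshift 1 0).
Proof.
rewrite (expand_det_row _ (lshift 1 0)) !big_ord_recl big_ord0 addr0.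
rewrite /cofactor !det_mx11 !mxE /= expr0 expr1 mul1r mulN1r mulrN.
congr (A _ _ * A _ _ - A _ _ * A _ _); exact: val_inj.
Qed.

Section TangentNorm.
Variables (R : realType) (n : nat) (M : manifold R n) (g : M -> 'M[R]_n).
Implicit Types (u v w : 'rV[R]_n) (p : M).

Definition dot p u v : R := (u *m g p *m v^T) 0 0.

Lemma dotDl p u v w : dot p (u + v) w = dot p u w + dot p v w.
Proof. by rewrite /dot !mulmxDl mxE. Qed.

Lemma dotZl p (k : R) u v : dot p (k *: u) v = k * dot p u v.
Proof. by rewrite /dot -!scalemxAl mxE. Qed.

Hypothesis g_sym : forall p, (g p)^T = g p.
Hypothesis g_pos : forall p v, v != 0 -> 0 < (v *m g p *m v^T) 0 0.

Lemma dotC p u v : dot p u v = dot p v u.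
Proof.
rewrite /dot -[in RHS](trmxK (v *m g p *m u^T)) [in RHS]mxE !trmx_mul trmxK g_sym.
by rewrite mulmxA.
Qed.

Lemma dotDr p u v w : dot p w (u + v) = dot p w u + dot p w v.
Proof. by rewrite dotC dotDl !(dotC p w). Qed.

Lemma dotZr p (k : R) u v : dot p u (k *: v) = k * dot p u v.
Proof. by rewrite dotC dotZl dotC. Qed.

Lemma dot_ge0 p v : 0 <= dot p v v.
Proof.
have [->|v0] := eqVneq v 0; first by rewrite /dot !mul0mx mxE.
by apply: ltW; exact: g_pos.
Qed.

Lemma dot_eq0 p v : (dot p v v == 0) = (v == 0).
Proof.
apply/eqP/eqP => [h|->]; last by rewrite /dot !mul0mx mxE.
by apply/eqP; apply: contraPT h => /(g_pos p)/gt_eqF/eqP.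
Qed.

Lemma tnorm_ge0 p v : 0 <= tnorm g p v.
Proof. exact: sqrtr_ge0. Qed.

Lemma sqr_tnorm p v : tnorm g p v ^+ 2 = dot p v v.
Proof. by rewrite sqr_sqrtr // dot_ge0. Qed.

Lemma tnorm_eq0 p v : (tnorm g p v == 0) = (v == 0).
Proof. by rewrite -(dot_eq0 p) -sqr_tnorm sqrf_eq0. Qed.

Lemma tnorm0 p : tnorm g p 0 = 0.
Proof. by apply/eqP; rewrite tnorm_eq0. Qed.

Lemma tnorm_gt0 p v : v != 0 -> 0 < tnorm g p v.
Proof. by rewrite lt0r tnorm_ge0 tnorm_eq0 andbT. Qed.

Lemma dot_CauchySchwarz p u v : dot p u v ^+ 2 <= dot p u u * dot p v v.
Proof.
have [->|v0] := eqVneq v 0.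
  by rewrite dotC /dot !mul0mx mxE expr0n mulr0.
have vv : 0 < dot p v v by exact: g_pos.
(* This vector is (v,v) times the part of [u] orthogonal to [v]; its square is (v,v) times the
   difference of the two sides. *)
have := dot_ge0 p (dot p v v *: u + (- dot p u v) *: v).
rewrite !dotDl !dotDr !dotZl !dotZr (dotC p v u).
by nra.
Qed.

Lemma normr_dot p u v : `|dot p u v| <= tnorm g p u * tnorm g p v.
Proof.
rewrite -ler_sqr ?nnegrE ?mulr_ge0 ?tnorm_ge0 //.
by rewrite exprMn !sqr_tnorm real_normK ?num_real // dot_CauchySchwarz.
Qed.

Lemma tnormD p u v : tnorm g p (u + v) <= tnorm g p u + tnorm g p v.
Proof.
rewrite -ler_sqr ?nnegrE ?addr_ge0 ?tnorm_ge0 // sqr_tnorm dotDl !dotDr.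
rewrite sqrrD !sqr_tnorm (dotC p v u).
have := le_trans (ler_norm _) (normr_dot p u v); lra.
Qed.

Lemma tnormZ p (k : R) v : tnorm g p (k *: v) = `|k| * tnorm g p v.
Proof.
rewrite -[LHS]/(Num.sqrt (dot p (k *: v) (k *: v))) dotZl dotZr mulrA -expr2.
by rewrite sqrtrM ?sqr_ge0 // sqrtr_sqr.
Qed.

Lemma tnormN p v : tnorm g p (- v) = tnorm g p v.
Proof. by rewrite -scaleN1r tnormZ normrN normr1 mul1r. Qed.

Lemma tnormB p u v : tnorm g p (u - v) <= tnorm g p u + tnorm g p v.
Proof. by rewrite -(tnormN p v) tnormD. Qed.

Lemma opnormP p q (A V : 'M[R]_n) (K : R) : 0 <= K ->
  (opnorm g p q A V <= K%:E)%E <->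
  (forall v, (v <= V)%MS -> tnorm g q (v *m A) <= K * tnorm g p v).
Proof.
move=> K0; split=> [h v vV|h]; last first.
  apply: ge_ereal_sup => _ [v [vV v1] <-]; rewrite lee_fin.
  by apply: le_trans (h v vV) _; rewrite ler_piMr.
have [->|v0] := eqVneq v 0; first by rewrite mul0mx !tnorm0 mulr0.
have Nv := tnorm_gt0 p v0.
pose w := (tnorm g p v)^-1 *: v.
have : ((tnorm g q (w *m A))%:E <= K%:E)%E.
  apply: le_trans h; apply: ereal_sup_ubound; exists w => //; split.
    exact: scalemx_sub.
  by rewrite tnormZ ger0_norm ?invr_ge0 ?tnorm_ge0 // mulVf ?gt_eqF.
rewrite lee_fin -scalemxAl tnormZ ger0_norm ?invr_ge0 ?tnorm_ge0 //.
by rewrite ler_pdivrMl // mulrC.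
Qed.

(* [perp x p] is the component orthogonal to [x], and [along x p] the linear
   form giving the component along [x]. *)
Definition along (x : 'rV[R]_n) p : 'cV[R]_n := (dot p x x)^-1 *: (g p *m x^T).

Definition perp x p v := v - (v *m along x p) 0 0 *: x.

Lemma alongE x p v : (v *m along x p) 0 0 = dot p v x / dot p x x.
Proof. by rewrite /along -scalemxAr mxE mulmxA mulrC. Qed.

Lemma along_self x p : x != 0 -> x *m along x p = 1%:M.
Proof.
move=> x0; apply/matrixP => i j; rewrite !ord1 alongE mxE eqxx.
by rewrite divff // dot_eq0.
Qed.

Lemma perpK x p v : v = (v *m along x p) 0 0 *: x + perp x p v.
Proof. by rewrite /perp addrC subrK. Qed.

Lemma dot_perp x p v : x != 0 -> dot p (perp x p v) x = 0.
Proof.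
move=> x0; have := dot_eq0 p x; rewrite (negPf x0) => /negbT xx.
by rewrite /perp -scaleNr dotDl dotZl alongE mulNr divfK // subrr.
Qed.

Lemma tnorm_along x p v : x != 0 ->
  `|(v *m along x p) 0 0| <= (tnorm g p x)^-1 * tnorm g p v.
Proof.
move=> x0; have Nx := tnorm_gt0 p x0.
rewrite alongE -sqr_tnorm normrM normfV normrX (ger0_norm (tnorm_ge0 _ _)).
rewrite ler_pdivrMr ?exprn_gt0 //.
apply: le_trans (normr_dot _ _ _) _.
have Nx0 : tnorm g p x != 0 by rewrite gt_eqF.
suff -> : (tnorm g p x)^-1 * tnorm g p v * tnorm g p x ^+ 2 =
  tnorm g p v * tnorm g p x by [].
by field.
Qed.

(** Pythagoras, multiplied by the square of [x] so that the right-hand side is the Gram determinant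
    of [x] and [v]. *)
Lemma sqr_tnorm_perp x p v : x != 0 ->
  dot p x x * tnorm g p (perp x p v) ^+ 2 = dot p x x * dot p v v - dot p x v ^+ 2.
Proof.
move=> x0; have := dot_eq0 p x; rewrite (negPf x0) => /negbT xx.
rewrite sqr_tnorm {2}/perp dotDr -scaleNr dotZr dot_perp // mulr0 addr0.
rewrite /perp -scaleNr dotDl dotZl alongE (dotC p v x).
by field.
Qed.

Lemma tnorm_perp x p v : x != 0 -> tnorm g p (perp x p v) <= tnorm g p v.
Proof.
move=> x0; rewrite -ler_sqr ?nnegrE ?tnorm_ge0 //.
have xx : 0 < dot p x x by exact: g_pos.
rewrite -(ler_pM2l xx) sqr_tnorm_perp // sqr_tnorm.
by rewrite gerBl sqr_ge0.
Qed.

(** Area is base times height. This is what converts expansion of areas of planes containing X into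
    expansion of the part orthogonal to X. *)
Lemma det_gram2 x p v : x != 0 ->
  \det (gram g p (col_mx x v)) = (tnorm g p x * tnorm g p (perp x p v)) ^+ 2.
Proof.
move=> x0; rewrite exprMn sqr_tnorm sqr_tnorm_perp //.
rewrite det_mx2 /gram mul_col_mx tr_col_mx mul_col_row.
rewrite block_mxEul block_mxEur block_mxEdl block_mxEdr -!/(dot p _ _).
by rewrite (dotC p v x) expr2.
Qed.

(** A change of basis by [Q] multiplies both Gram determinants by the square of its determinant,
    which cancels. Planes can thus be measured in the basis given by X and v. *)
Lemma absdetE p q (A P : 'M[R]_n) (k : nat) (W : 'M[R]_(k, n)) :
  row_free W -> (P :=: W)%MS ->
  absdet g p q A P =
  Num.sqrt (\det (gram g q (W *m A))) / Num.sqrt (\det (gram g p W)).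
Proof.
move=> Wf PW; rewrite /absdet.
have rP : \rank P = k by rewrite PW; exact/eqP.
have BW : (row_base P :=: W)%MS by apply: eqmx_trans PW; exact: eq_row_base.
have Bf : row_free (row_base P) := row_base_free P.
(* The type of [row_base P] mentions the rank of [P]; generalising it lets the rank become [k]. *)
move: (row_base P) BW Bf; rewrite rP => B BW Bf.
have /submxP[Q BQ] : (B <= W)%MS by rewrite BW.
have Qu : Q \in unitmx.
  rewrite -row_free_unit -row_leq_rank; move: Bf; rewrite -row_leq_rank BQ.
  by move=> /leq_trans; apply; exact: mxrankM_maxl.
have dQ : \det Q != 0 by move: Qu; rewrite unitmxE unitfE.
have gr r (C : 'M[R]_(k, n)) : \det (gram g r (Q *m C)) = \det Q ^+ 2 * \det (gram g r C).
  have -> : gram g r (Q *m C) = Q *m gram g r C *m Q^T.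
    by rewrite /gram trmx_mul !mulmxA.
  by rewrite !det_mulmx det_tr mulrAC -expr2.
rewrite BQ -mulmxA !gr !(sqrtrM _ (sqr_ge0 (\det Q))) sqrtr_sqr.
by rewrite invfM mulrACA divff ?mul1r // normr_eq0.
Qed.

End TangentNorm.

(** * The invariant form *)

Section GeometricEstimates.
Variable R : realType.
Implicit Types (a K r : R).

(** Applied to the distance of two quantities, this is how limits are identified below. *)
Lemma geometric_le0 a K r : 0 <= r < 1 -> (forall k, a <= K * r ^+ k) -> a <= 0.
Proof.
move=> /andP[r0 r1] h; rewrite leNgt; apply/negP => a0.
have c : (fun k => K * r ^+ k) @ \oo --> (0 : R).
  rewrite -(mulr0 K); apply: cvgM; first exact: cvg_cst.
  by apply: cvg_expr; rewrite ger0_norm.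
have [k] := filter_ex (cvgr_lt _ c _ a0).
by rewrite ltNge h.
Qed.

(** K / (1 - r) r^k is the tail of the geometric series. Subtracting it from [u] gives an increasing
    sequence, adding it a decreasing one; the limit is the supremum of the former. *)
Lemma geometric_limit (u : nat -> R) K r : 0 <= r < 1 ->
  (forall k, `|u k.+1 - u k| <= K * r ^+ k) ->
  exists l, forall k, `|u k - l| <= K / (1 - r) * r ^+ k.
Proof.
move=> /andP[r0 r1] h; set S := K / (1 - r).
have r1' : 0 < 1 - r by rewrite subr_gt0.
have KS : K = S * (1 - r) by rewrite divfK ?gt_eqF.
have K0 : 0 <= K by have := le_trans (normr_ge0 _) (h 0%N); rewrite expr0 mulr1.
have S0 : 0 <= S by rewrite divr_ge0 // ltW.
have rk k : 0 <= S * r ^+ k by rewrite mulr_ge0 // exprn_ge0.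
pose b k := u k - S * r ^+ k; pose c k := u k + S * r ^+ k.
have bS : {homo b : i j / (i <= j)%N >-> i <= j}.
  apply/nondecreasing_seqP => k; have := h k; rewrite ler_norml KS => /andP[+ _].
  rewrite /b exprS; move: (r ^+ k) => rk'; nra.
have cS : {homo c : i j / (i <= j)%N >-> j <= i}.
  apply/nonincreasing_seqP => k; have := h k; rewrite ler_norml KS => /andP[_ +].
  rewrite /c exprS; move: (r ^+ k) => rk'; nra.
have bc i j : b i <= c j.
  apply: le_trans (bS _ _ (leq_maxl i j)) _; apply: le_trans (cS _ _ (leq_maxr i j)).
  by rewrite /b /c lerD2l; apply: le_trans (rk _); rewrite oppr_le0.
have sb : has_sup (range b).
  by split; [exists (b 0%N), 0%N | exists (c 0%N) => _ [i _ <-]].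
exists (sup (range b)) => k.
have h1 : b k <= sup (range b) by apply: ub_le_sup; [exact: sb.2 | exists k].
have h2 : sup (range b) <= c k.
  by apply: ge_sup; [exact: sb.1 | move=> _ [i _ <-]].
rewrite distrC ler_norml; move: h1 h2; rewrite /b /c; lra.
Qed.

Lemma expRN_nat (l : R) k : expR (- (l * k%:R)) = expR (- l) ^+ k.
Proof. by rewrite -mulNr expRM_natr. Qed.

Lemma expRN_itv (l : R) : 0 < l -> 0 <= expR (- l) < 1.
Proof. by move=> l0; rewrite expR_ge0 expR_lt1 oppr_lt0. Qed.

End GeometricEstimates.

(** * Backward pullbacks of the component along X, and their limit *)

Section InvariantForm.
(** [A t x] stands for DX_t at x and [pF x] for the projection onto F along E. From here to the end
    of the section only linear algebra and uniform bounds enter; continuity is treated later. *)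
Variables (R : realType) (n : nat) (M : manifold R n) (g : M -> 'M[R]_n)
  (phi : R -> M -> M) (A : R -> M -> 'M[R]_n) (Lam : set M)
  (X : M -> 'rV[R]_n) (pF : M -> 'M[R]_n).
Implicit Types (s t : R) (x : M) (v w : 'rV[R]_n) (K : R).
Local Notation N := (tnorm g).

Hypotheses (g_sym : forall p, (g p)^T = g p)
  (g_pos : forall p (v : 'rV[R]_n), v != 0 -> 0 < (v *m g p *m v^T) 0 0)
  (phi_Lam : forall t x, Lam x -> Lam (phi t x))
  (phi0 : forall x, phi 0 x = x)
  (phiD : forall s t x, Lam x -> phi s (phi t x) = phi (t + s) x)
  (A0 : forall x, Lam x -> A 0 x = 1%:M)
  (AD : forall s t x, Lam x -> A t x *m A s (phi t x) = A (t + s) x)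
  (XA : forall t x, Lam x -> X x *m A t x = X (phi t x))
  (X0 : forall x, Lam x -> X x != 0)
  (pFK : forall x, Lam x -> pF x *m pF x = pF x)
  (pFA : forall t x, Lam x -> pF x *m A t x = A t x *m pF (phi t x)).

Variables (CE lE KX cX KF : R).
Hypotheses (CE0 : 0 <= CE) (lE0 : 0 < lE) (cX0 : 0 < cX)
  (contraction : forall x t v, Lam x -> 0 <= t ->
     N (phi t x) ((v - v *m pF x) *m A t x) <=
     CE * expR (- (lE * t)) * N x (v - v *m pF x))
  (N_X_le : forall x, Lam x -> N x (X x) <= KX)
  (N_X_ge : forall x, Lam x -> cX <= N x (X x))
  (N_pF : forall x v, Lam x -> N x (v *m pF x) <= KF * N x v).

Lemma phiNK t x : Lam x -> phi t (phi (- t) x) = x.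
Proof. by move=> Lx; rewrite phiD // addNr phi0. Qed.

Lemma phiKN t x : Lam x -> phi (- t) (phi t x) = x.
Proof. by move=> Lx; rewrite phiD // subrr phi0. Qed.

Lemma ANK t x : Lam x -> A (- t) x *m A t (phi (- t) x) = 1%:M.
Proof. by move=> Lx; rewrite AD // addNr A0. Qed.

Lemma AKN t x : Lam x -> A t x *m A (- t) (phi t x) = 1%:M.
Proof. by move=> Lx; rewrite AD // subrr A0. Qed.

(* The component of X along the contracted bundle grows exponentially in
   backward time, whereas X is bounded on the compact set. *)
Lemma X_in_F x : Lam x -> X x *m pF x = X x.
Proof.
move=> Lx; apply/eqP; rewrite eq_sym -subr_eq0 -(tnorm_eq0 g_pos x).
rewrite eq_le tnorm_ge0 andbT.
(* The component along E of X at time -k has norm at most [KX + KF * KX]; carrying it forward to [x]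
   costs [CE] and the k-th power of [expR (- lE)]. *)
apply: (geometric_le0 (K := CE * (KX + KF * KX)) (expRN_itv lE0)) => k.
have Ly := phi_Lam (- k%:R) Lx; set y := phi (- k%:R) x in Ly.
have yx : phi k%:R y = x by exact: phiNK.
have eA : (X y - X y *m pF y) *m A k%:R y = X x - X x *m pF x.
  by rewrite mulmxBl -mulmxA pFA // mulmxA XA // yx.
have := contraction (X y) Ly (ler0n _ k); rewrite eA yx expRN_nat => /le_trans; apply.
rewrite mulrAC; apply: ler_wpM2r; first by rewrite exprn_ge0 // expR_ge0.
rewrite ler_wpM2l //.
apply: le_trans (tnormB g_sym g_pos _ _ _) _.
apply: lerD; first exact: N_X_le.
apply: le_trans (N_pF _ Ly) _; rewrite ler_wpM2l ?N_X_le //.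
have Nx : 0 < N y (X y) by apply: lt_le_trans cX0 (N_X_ge Ly).
have := le_trans (tnorm_ge0 _ _ _) (N_pF (X y) Ly).
by rewrite pmulr_lge0.
Qed.

Variables (CF lF : R).
Hypotheses (CF0 : 0 < CF) (lF0 : 0 < lF)
  (N_A : forall s, exists K, forall x v, Lam x ->
     N (phi s x) (v *m A s x) <= K * N x v)
  (expansion : forall t x v, Lam x -> v *m pF x = v -> 0 < t ->
     CF * expR (lF * t) * (N x (X x) * N x (perp g (X x) x v)) <=
     N (phi t x) (X (phi t x)) *
       N (phi t x) (perp g (X (phi t x)) (phi t x) (v *m A t x))).

Local Notation al x := (along g (X x) x).
Local Notation P x v := (perp g (X x) x v).

Let KX0 x : Lam x -> 0 < KX.
Proof. by move=> Lx; apply: lt_le_trans cX0 (le_trans (N_X_ge Lx) (N_X_le Lx)). Qed.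

(** The first summand comes from sectional expansion at positive times; the summand 1 covers time 0,
    about which [expansion] says nothing. *)
Let KP := (CF * cX)^-1 * KX + 1.

(** Expansion is applied at [phi (- t) x] to the preimage of [v]; the bounds of the norm of X at
    both ends of the orbit segment strip the areas of their bases. *)
Lemma perp_backward t x v : Lam x -> v *m pF x = v -> 0 <= t ->
  N (phi (- t) x) (P (phi (- t) x) (v *m A (- t) x)) <=
  KP * expR (- (lF * t)) * N x v.
Proof.
move=> Lx vF; have K0 := KX0 Lx.
have Cc0 : 0 < CF * cX by rewrite mulr_gt0.
have KP1 : 1 <= KP by rewrite /KP lerDr mulr_ge0 ?invr_ge0 ?ltW.
have Ppos : N x (P x v) <= N x v by apply: tnorm_perp => //; exact: X0.
rewrite le_eqVlt => /predU1P[<-|t0].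
  rewrite oppr0 phi0 A0 // mulmx1 mulr0 oppr0 expR0 mulr1.
  by apply: le_trans Ppos _; rewrite ler_peMl // tnorm_ge0.
have Ly := phi_Lam (- t) Lx; set y := phi (- t) x in Ly *.
have yx : phi t y = x by exact: phiNK.
have vA : v *m A (- t) x *m A t y = v by rewrite -mulmxA ANK // mulmx1.
have uF : v *m A (- t) x *m pF y = v *m A (- t) x.
  by rewrite -mulmxA -pFA // mulmxA vF.
have := expansion Ly uF t0; rewrite vA yx => h.
have h1 : CF * expR (lF * t) * (cX * N y (P y (v *m A (- t) x))) <= KX * N x v.
  apply: le_trans (_ : _ <= CF * expR (lF * t) * (N y (X y) * N y (P y (v *m A (- t) x)))) _.
    apply: ler_wpM2l; first by rewrite mulr_ge0 ?expR_ge0 // ltW.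
    by rewrite ler_wpM2r ?tnorm_ge0 ?N_X_ge.
  apply: le_trans h _; apply: ler_pM; rewrite ?tnorm_ge0 //; exact: N_X_le.
have h2 : N y (P y (v *m A (- t) x)) <= (CF * cX)^-1 * KX * expR (- (lF * t)) * N x v.
  rewrite expRN -!mulrA ler_pdivlMl // mulrCA ler_pdivlMl ?expR_gt0 //.
  apply: le_trans h1; rewrite le_eqVlt; apply/predU1P; left; ring.
apply: le_trans h2 _; rewrite ler_wpM2r ?tnorm_ge0 // ler_wpM2r ?expR_ge0 //.
by rewrite /KP lerDl.
Qed.

Let rF := expR (- lF).

(* The linear form [along] at time -t, pulled back to the present through F. *)
Definition pulled t x : 'cV[R]_n := pF x *m A (- t) x *m al (phi (- t) x).

Let KF1 x : Lam x -> 0 <= KF.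
Proof.
move=> Lx; have Nx : 0 < N x (X x) by apply: lt_le_trans cX0 (N_X_ge Lx).
have := le_trans (tnorm_ge0 _ _ _) (N_pF (X x) Lx).
by rewrite pmulr_lge0.
Qed.

Lemma along_le x v : Lam x -> `|(v *m al x) 0 0| <= cX^-1 * N x v.
Proof.
move=> Lx; apply: le_trans (tnorm_along g_sym g_pos _ _ (X0 Lx)) _.
rewrite ler_wpM2r ?tnorm_ge0 // lef_pV2 ?posrE ?N_X_ge //.
by apply: lt_le_trans cX0 (N_X_ge Lx).
Qed.

(** Going back a further time [s] carries X to X, on which [along] is again 1, so the component
    along X cancels and only the decaying orthogonal part contributes. Taking [s] to be 1 gives
    convergence, a general [s] gives invariance. *)
Lemma pulled_diff s : exists K, 0 <= K /\ forall x t w, Lam x -> 0 <= t ->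
  `|(w *m pulled (t + s) x) 0 0 - (w *m pulled t x) 0 0| <=
  K * expR (- (lF * t)) * N x w.
Proof.
have [K0 hK0] := N_A (- s).
(* The factors come from [along_le], from DX over the fixed time [- s], from [perp_backward] and
   from [N_pF]. The signs of [KX] and [KF] are known only once [Lam] has a point, so the witness is
   the absolute value. *)
pose K := cX^-1 * (`|K0| * (KP * KF)).
exists `|K|; split => // x t w Lx t0.
have Ly := phi_Lam (- t) Lx; set y := phi (- t) x in Ly.
set u := w *m pF x *m A (- t) x.
have wF : w *m pF x *m pF x = w *m pF x by rewrite -mulmxA pFK.
have e1 : w *m pulled t x = u *m al y by rewrite /pulled /u !mulmxA.
have zE : phi (- s) y = phi (- (t + s)) x by rewrite phiD // opprD.
have e2 : w *m pulled (t + s) x = u *m A (- s) y *m al (phi (- s) y).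
  by rewrite /pulled -zE opprD -AD // !mulmxA.
have Lz := phi_Lam (- s) Ly.
have e3 : (w *m pulled (t + s) x) 0 0 - (w *m pulled t x) 0 0 =
    (P y u *m A (- s) y *m al (phi (- s) y)) 0 0.
  rewrite e1 e2; have := perpK g (X y) y u; move: (P y u) => q hq.
  rewrite {1}hq !mulmxDl mxE -!scalemxAl XA // along_self //; last exact: X0.
  have one (c : R) : (c *: (1%:M : 'M[R]_1)) 0 0 = c by rewrite !mxE eqxx mulr1.
  by rewrite one addrAC subrr add0r.
rewrite e3; apply: le_trans (along_le _ Lz) _.
apply: le_trans (_ : _ <= K * expR (- (lF * t)) * N x w) _; last first.
  by rewrite ler_wpM2r ?tnorm_ge0 // ler_wpM2r ?expR_ge0 // ler_norm.
rewrite /K -!mulrA; apply: ler_wpM2l; first by rewrite invr_ge0 ltW.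
apply: le_trans (hK0 _ _ Ly) _.
apply: (@le_trans _ _ (`|K0| * N y (P y u))).
  by rewrite ler_wpM2r ?tnorm_ge0 // ler_norm.
rewrite ler_wpM2l //.
apply: le_trans (perp_backward Lx wF t0) _.
rewrite -!mulrA ler_wpM2l //; last first.
  rewrite mulrCA ler_wpM2l ?expR_ge0 //; exact: N_pF.
have K1 := KX0 Lx.
by rewrite addr_ge0 // mulr_ge0 ?invr_ge0 ?mulr_ge0 ?ltW.
Qed.

Lemma pulled_nat_diff : exists K, 0 <= K /\ forall x k w, Lam x ->
  `|(w *m pulled k.+1%:R x) 0 0 - (w *m pulled k%:R x) 0 0| <=
  K * N x w * rF ^+ k.
Proof.
have [K [K0 hK]] := pulled_diff 1; exists K; split => // x k w Lx.
by have := hK x k%:R w Lx (ler0n _ k); rewrite natr1 expRN_nat mulrAC.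
Qed.

(** The rate is part of the definition: it identifies the values of [a] and makes the convergence
    uniform, whence continuity. *)
Definition limit_form (a : M -> 'cV[R]_n) K := forall x k w, Lam x ->
  `|(w *m pulled k%:R x) 0 0 - (w *m a x) 0 0| <= K * N x w * rF ^+ k.

Lemma limit_form_ex : exists a K, 0 <= K /\ limit_form a K.
Proof.
have [K [K0 hK]] := pulled_nat_diff.
have rF1 := expRN_itv lF0.
pose K' := K / (1 - rF).
have ex x : exists b : 'cV[R]_n, Lam x -> forall k w,
    `|(w *m pulled k%:R x) 0 0 - (w *m b) 0 0| <= K' * N x w * rF ^+ k.
  have [Lx|nL] := pselect (Lam x); last by exists 0.
  have lw w : exists l, forall k, `|(w *m pulled k%:R x) 0 0 - l| <= K' * N x w * rF ^+ k.
    have [l hl] := geometric_limit rF1 (fun k => hK x k w Lx).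
    by exists l => k; apply: le_trans (hl k) _; rewrite /K' (mulrAC K).
  have [l hl] := choice (fun i : 'I_n => lw (delta_mx 0 i)).
  exists (\col_i l i) => _ k w.
  (* The entries of the column are limits on basis vectors. To keep the constant [K'] for every [w],
     its own limit [lw'] is taken first and then identified with the value of the column. *)
  have [lw' hw] := lw w; suff <- : lw' = (w *m \col_i l i) 0 0 by exact: hw.
  apply/eqP; rewrite -subr_eq0 -normr_le0.
  (* The sum in the constant collects the errors on the basis vectors, weighted by the entries of
     [w]. *)
  apply: (geometric_le0 (r := rF) (K := K' * N x w + \sum_i `|w 0 i| * (K' * N x (delta_mx 0 i)))) => // j.
  have -> : lw' - (w *m \col_i l i) 0 0 = - ((w *m pulled j%:R x) 0 0 - lw') +
     \sum_i w 0 i * (((delta_mx 0 i : 'rV[R]_n) *m pulled j%:R x) 0 0 - l i).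
    rewrite opprB -addrA; congr (_ + _).
    under [in RHS]eq_bigr do rewrite mulrBr -rowE mxE.
    rewrite sumrB !mxE addKr; congr (- _).
    by apply: eq_bigr => i _; rewrite mxE.
  apply: le_trans (ler_normD _ _) _; rewrite normrN mulrDl; apply: lerD => //.
  apply: le_trans (ler_norm_sum _ _ _) _; rewrite mulr_suml; apply: ler_sum => i _.
  by rewrite normrM -mulrA ler_wpM2l.
have [a ha] := choice ex.
exists a, K'; split; last by move=> x k w Lx; exact: ha.
by rewrite divr_ge0 // subr_ge0 ltW //; case/andP: rF1.
Qed.

Section LimitForm.
Variables (a : M -> 'cV[R]_n) (Ka : R).
Hypothesis a_limit : limit_form a Ka.

Let form_eq x (b : R) K w : Lam x ->
  (forall k, `|(w *m pulled k%:R x) 0 0 - b| <= K * rF ^+ k) ->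
  (w *m a x) 0 0 = b.
Proof.
move=> Lx h; apply/eqP; rewrite -subr_eq0 -normr_le0.
apply: (geometric_le0 (K := Ka * N x w + K) (expRN_itv lF0)) => k.
rewrite mulrDl; set c := (w *m pulled k%:R x) 0 0.
have -> : (w *m a x) 0 0 - b = - (c - (w *m a x) 0 0) + (c - b).
  by rewrite opprB addrA subrK.
apply: le_trans (ler_normD _ _) _; rewrite normrN; apply: lerD; last exact: h.
exact: a_limit.
Qed.

Let mx11_eq (b c : 'cV[R]_n) :
  (forall w : 'rV[R]_n, (w *m b) 0 0 = (w *m c) 0 0) -> b = c.
Proof.
move=> h; apply/matrixP => i j; rewrite (ord1 j).
by have := h (delta_mx 0 i); rewrite -!rowE !mxE.
Qed.

Lemma form_pF x : Lam x -> pF x *m a x = a x.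
Proof.
move=> Lx; apply: mx11_eq => w; apply/esym; rewrite mulmxA.
apply: (form_eq Lx) => k.
have -> : pulled k%:R x = pF x *m pulled k%:R x by rewrite /pulled !mulmxA pFK.
rewrite mulmxA.
exact: a_limit.
Qed.

(** Each pulled-back form is already 1 on X, because X lies in F and is invariant; hence the error
    constant 0. *)
Lemma form_X x : Lam x -> X x *m a x = 1%:M.
Proof.
move=> Lx; apply/matrixP => i j; rewrite !ord1 [RHS]mxE eqxx.
apply: (form_eq (K := 0) Lx) => k.
have Ly := phi_Lam (- k%:R) Lx.
rewrite /pulled !mulmxA X_in_F // XA // along_self //; last exact: X0.
by rewrite mxE eqxx subrr normr0 mul0r.
Qed.

(** The form pulled back over time k + s to [phi s x], then to [x] by DX_s, is the one pulled back
    over time k to [x]. [pulled_diff] makes the extra time [s] negligible as k grows. *)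
Let form_invariant_ge0 s x : Lam x -> 0 <= s -> A s x *m a (phi s x) = a x.
Proof.
move=> Lx s0; have Ly := phi_Lam s Lx.
apply: mx11_eq => w; apply/esym; rewrite mulmxA.
have [K [K0 hK]] := pulled_diff s.
apply: (form_eq (K := (K + Ka) * N (phi s x) (w *m A s x)) Lx) => k.
have sk : s - (k%:R + s) = - k%:R by rewrite opprD addrCA subrr addr0.
have -> : w *m pulled k%:R x = w *m A s x *m pulled (k%:R + s) (phi s x).
  rewrite /pulled phiD // sk -!mulmxA; congr (_ *m _).
  by rewrite mulmxA -sk -(AD _ _ Lx) mulmxA pFA // -!mulmxA.
set v := w *m A s x.
apply: le_trans (ler_distD ((v *m pulled k%:R (phi s x)) 0 0) _ _) _.
rewrite mulrDl mulrDl; apply: lerD; last exact: a_limit.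
by have := hK (phi s x) k%:R v Ly (ler0n _ k); rewrite expRN_nat mulrAC.
Qed.

Lemma form_invariant s x : Lam x -> A s x *m a (phi s x) = a x.
Proof.
move=> Lx; have [s0|s0] := leP 0 s; first exact: form_invariant_ge0.
have Ly := phi_Lam s Lx.
have s0' : 0 <= - s by rewrite oppr_ge0 ltW.
by rewrite -(form_invariant_ge0 Ly s0') phiKN // mulmxA AKN // mul1mx.
Qed.

(** The form of index 0 is the projection to F followed by [along], which gives the first summand;
    its distance to the limit gives [Ka]. *)
Lemma form_le x w : 0 <= Ka -> Lam x ->
  `|(w *m a x) 0 0| <= (cX^-1 * KF + Ka) * N x w.
Proof.
move=> Ka0 Lx; rewrite -[X in `|X|](subrK ((w *m pulled 0%:R x) 0 0)).
rewrite mulrDl addrC; apply: le_trans (ler_normD _ _) _; apply: lerD.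
  rewrite /pulled mulr0n oppr0 A0 // mulmx1 phi0 mulmxA.
  apply: le_trans (along_le _ Lx) _; rewrite -mulrA ler_wpM2l ?N_pF //.
  by rewrite invr_ge0 ltW.
rewrite distrC; apply: le_trans (a_limit 0%N w Lx) _.
by rewrite expr0 mulr1.
Qed.

(** Since a(X) = 1, a vector u with a(u) = 0 has component -a(P u) along X, where P u is its
    orthogonal part. So the norm of u is at most a constant times that of P u, which decays by
    [perp_backward]. *)
Lemma form_kernel_contracted : 0 <= Ka -> exists K, 0 <= K /\
  forall x t w, Lam x -> 0 <= t -> w *m pF x = w -> w *m a x = 0 ->
  N (phi (- t) x) (w *m A (- t) x) <= K * expR (- (lF * t)) * N x w.
Proof.
move=> Ka0; pose K := (1 + (cX^-1 * KF + Ka) * KX) * KP.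
exists `|K|; split => // x t w Lx t0 wF wa.
have Ly := phi_Lam (- t) Lx; set y := phi (- t) x in Ly *.
set u := w *m A (- t) x.
have KX1 := KX0 Lx; have KF1' := KF1 Lx.
have ua : u *m a y = 0 by rewrite /u -mulmxA form_invariant.
have hu := perpK g (X y) y u.
have : (u *m a y) 0 0 = (u *m al y) 0 0 + (P y u *m a y) 0 0.
  rewrite {1}hu mulmxDl -scalemxAl form_X // mxE; congr (_ + _).
  by rewrite !mxE eqxx mulr1.
rewrite ua [LHS]mxE => /esym/eqP; rewrite addr_eq0 => /eqP ual.
have c0 : 0 <= cX^-1 * KF + Ka by rewrite addr_ge0 // mulr_ge0 // invr_ge0 ltW.
have h1 : N y u <= (1 + (cX^-1 * KF + Ka) * KX) * N y (P y u).
  rewrite {1}hu addrC; apply: le_trans (tnormD g_sym g_pos _ _ _) _.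
  rewrite mulrDl mul1r lerD2l (tnormZ g_sym) ual normrN.
  apply: (@le_trans _ _ ((cX^-1 * KF + Ka) * N y (P y u) * KX)); last by rewrite mulrAC.
  apply: ler_pM => //; [exact: tnorm_ge0|exact: form_le|exact: N_X_le].
apply: le_trans h1 _.
have c1 : 0 <= 1 + (cX^-1 * KF + Ka) * KX by rewrite addr_ge0 // mulr_ge0 // ltW.
apply: (@le_trans _ _ (K * expR (- (lF * t)) * N x w)).
  rewrite /K -!mulrA ler_wpM2l // mulrA; exact: perp_backward.
by rewrite ler_wpM2r ?tnorm_ge0 // ler_wpM2r ?expR_ge0 // ler_norm.
Qed.

End LimitForm.

Lemma invariant_form : exists (a : M -> 'cV[R]_n) (K Ka : R),
  [/\ 0 <= Ka /\ limit_form a Ka,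
      forall x, Lam x -> pF x *m a x = a x,
      forall x, Lam x -> X x *m a x = 1%:M,
      forall t x, Lam x -> A t x *m a (phi t x) = a x &
      0 <= K /\ forall x t w, Lam x -> 0 <= t ->
        w *m pF x = w -> w *m a x = 0 ->
        N (phi (- t) x) (w *m A (- t) x) <= K * expR (- (lF * t)) * N x w].
Proof.
have [a [Ka [Ka0 ha]]] := limit_form_ex.
have [K [K0 hK]] := form_kernel_contracted ha Ka0.
exists a, K, Ka; split => //.
- exact: form_pF ha.
- exact: form_X ha.
- by move=> t x Lx; exact: (form_invariant ha).
Qed.

End InvariantForm.

(** * Continuous bundle maps *)

Lemma cvg_near_eq (T U : Type) (F : set_system T) (f h : T -> U)
    (G : set_system U) {FF : Filter F} :
  (\forall x \near F, f x = h x) -> f @ F --> G -> h @ F --> G.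
Proof.
move=> fh fG W /fG; apply: (@filterS2 _ F FF _ _ _ _ fh) => x /= ->.
by [].
Qed.

Lemma near_comp (T U : Type) (f : T -> U) (F : set_system T) (G : set_system U)
    (P : U -> Prop) :
  f x @[x --> F] --> G -> (\forall y \near G, P y) -> \forall x \near F, P (f x).
Proof. by move=> fG GP; exact: (fG P GP). Qed.

Lemma mulmx_insert (R : comNzRingType) (k l m n p q : nat) (S : 'M[R]_(k, l))
    (A : 'M[R]_(l, m)) (T : 'M[R]_(m, n)) (S' : 'M[R]_(n, m)) (B : 'M[R]_(m, p))
    (T' : 'M[R]_(p, q)) :
  T *m S' = 1%:M ->
  (S *m A *m T) *m (S' *m B *m T') = S *m (A *m B) *m T'.
Proof. by move=> TS; rewrite !mulmxA -(mulmxA _ T) TS mulmx1. Qed.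

(** * Quadratic forms compared with a positive definite one *)

Section PositiveForms.
Variables (R : realType) (n : nat).
Implicit Types (G H : 'M[R]_n) (u : 'rV[R]_n).

Definition posdef G := G^T = G /\ forall u, u != 0 -> 0 < (u *m G *m u^T) 0 0.

Lemma posdef_unit G : posdef G -> G \in unitmx.
Proof.
move=> [_ Gpos]; rewrite -row_free_unit -kermx_eq0; apply/eqP/row_matrixP => i.
rewrite row0; apply/eqP; apply: contraT => /Gpos.
by rewrite (sub_kermxP (row_sub i (kermx G))) mul0mx mxE ltxx.
Qed.

(** Cauchy-Schwarz for [G] against e_i G^-1, whose product with [u] is u_i and whose square is a
    diagonal entry of G^-1. [M] and [p] let [G] be read as a constant metric. *)
Lemma posdef_entry (M : manifold R n) (p : M) G u i : posdef G ->
  u 0 i ^+ 2 <= invmx G i i * (u *m G *m u^T) 0 0.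
Proof.
move=> Gp; have Gu := posdef_unit Gp; have [Gs G0] := Gp.
pose w := delta_mx 0 i *m invmx G : 'rV[R]_n.
have := @dot_CauchySchwarz _ _ M (fun=> G) (fun=> Gs) (fun=> G0) p u w.
have GiT : (invmx G)^T = invmx G by rewrite trmx_inv Gs.
have -> : dot (fun=> G) p u w = u 0 i.
  by rewrite /dot /w trmx_mul GiT mulmxA mulmxK // trmx_delta -colE mxE.
suff -> : dot (fun=> G) p w w = invmx G i i by rewrite mulrC.
by rewrite /dot /w trmx_mul GiT mulmxKV // mulmxA trmx_delta -rowE -colE !mxE.
Qed.

(** The constant is explicit so as to be continuous in [H] and in the inverse of [G], hence locally
    bounded along [Lam]. *)
Lemma quad_form_le (M : manifold R n) (p : M) G H u : posdef G ->
  (u *m H *m u^T) 0 0 <=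
  (\sum_i \sum_j `|H i j| * (invmx G i i + invmx G j j)) * (u *m G *m u^T) 0 0.
Proof.
move=> Gp; have hu i := posdef_entry p u i Gp.
move: hu; set q := (u *m G *m u^T) 0 0 => hu.
rewrite mxE (eq_bigr (fun j => \sum_i u 0 i * H i j * u 0 j)); last first.
  by move=> j _; rewrite !mxE mulr_suml.
rewrite exchange_big mulr_suml /=; apply: ler_sum => i _.
rewrite mulr_suml; apply: ler_sum => j _.
apply: (@le_trans _ _ (`|H i j| * (u 0 i ^+ 2 + u 0 j ^+ 2))); last first.
  by rewrite -mulrA mulrDl ler_wpM2l // lerD.
apply: le_trans (ler_norm _) _.
rewrite !normrM mulrAC [leLHS]mulrC ler_wpM2l //.
rewrite -(real_normK (num_real (u 0 i))) -(real_normK (num_real (u 0 j))).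
have := normr_ge0 (u 0 i); have := normr_ge0 (u 0 j); nra.
Qed.

End PositiveForms.

Section CompactBounds.
Variables (R : realType) (T : topologicalType) (L : set T).

(** A local bound holds for all large [K] by monotonicity; near-covering compactness, for the filter
    of large reals, then gives one [K] for all of [L]. *)
Lemma compact_uniform_bound (P : R -> T -> Prop) : compact L ->
  (forall K K' x, K <= K' -> P K x -> P K' x) ->
  (forall q, L q -> exists K, \forall x \near within L (nbhs q), P K x) ->
  exists K, 0 <= K /\ forall x, L x -> P K x.
Proof.
move=> cL mono loc.
have [K [K0 hK]] : \forall K \near +oo, forall x, L x -> P K x.
  have /compact_near_coveringP/near_covering_withinP h := cL.
  apply: (h R (pinfty_nbhs R) P) => q Lq.
  have [K0 hK0] := loc q Lq.
  exists ([set x | L x -> P K0 x], [set K | K0 <= K]).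
    split => //=; exists K0; split; first exact: num_real.
    by move=> K /ltW.
  by move=> [x K] /= [hx K0K] Lx; apply: mono (hx Lx).
exists (`|K| + 1); split => // x Lx; apply: hK => //.
by apply: le_lt_trans (ler_norm K) _; rewrite ltrDl.
Qed.

End CompactBounds.

(** * Bundle maps in fixed charts, and uniform bounds on the compact set *)

Section BundleMaps.
Variables (R : realType) (n : nat) (M : manifold R n) (g : M -> 'M[R]_n)
  (Lam : set M).
Hypotheses (hg : riemannian_metric g)
  (Lam_inner : forall x, Lam x -> inner (chart_at x) x)
  (Lam_compact : compact Lam).
Implicit Types (p q x : M) (psi chi : M -> M) (A B : M -> 'M[R]_n).

(** Components at [x] refer to [chart_at x], which may jump with [x]; these matrices pass to and
    from one chart kept fixed near [q]. *)
Definition to_chart q x : 'M[R]_n := change_coord (chart_at x) (chart_at q) x.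
Definition from_chart q x : 'M[R]_n := change_coord (chart_at q) (chart_at x) x.

Lemma near_chart_inverse q : Lam q -> \forall x \near within Lam (nbhs q),
  to_chart q x *m from_chart q x = 1%:M /\ from_chart q x *m to_chart q x = 1%:M.
Proof.
move=> Lq; rewrite near_withinE; have := inner_near (Lam_inner Lq).
apply: filterS => x iq Lx; have ix := Lam_inner Lx.
split; rewrite /to_chart /from_chart change_coordM ?change_coord_id //.
  exact: ix.1.
exact: iq.1.
Qed.

Lemma to_chart_id q : Lam q -> to_chart q q = 1%:M.
Proof. by move=> Lq; rewrite /to_chart change_coord_id //; exact: Lam_inner. Qed.

Lemma from_chart_id q : Lam q -> from_chart q q = 1%:M.
Proof. exact: to_chart_id. Qed.

Lemma to_chartE q x :
  to_chart q x = change_coord (chart_at x) (chart_at q) x.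
Proof. by []. Qed.

Lemma from_chartE q x :
  from_chart q x = change_coord (chart_at q) (chart_at x) x.
Proof. by []. Qed.

(* Unification would otherwise unfold these to Jacobians. *)
Opaque to_chart from_chart.

(* Bundle maps over [psi] are compared with their value at [q] in the charts
   at [q] and [psi q]. *)
Definition cont_map psi A := forall q, Lam q ->
  from_chart q x *m A x *m to_chart (psi q) (psi x)
    @[x --> within Lam (nbhs q)] --> A q.

Definition cont_base psi := forall q, Lam q ->
  psi x @[x --> within Lam (nbhs q)] --> within Lam (nbhs (psi q)).

Definition chart_metric q x : 'M[R]_n := from_chart q x *m g x *m (from_chart q x)^T.

Lemma chart_metric_cvg q : Lam q ->
  chart_metric q x @[x --> within Lam (nbhs q)] --> g q.
Proof.
move=> Lq; have iq := Lam_inner Lq; have [gsym gpos gsm] := hg.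
set c := chart_at q.
have [tq kq] := coordK iq.1.
have [U [h [oU Uq hC gh]]] := gsm q (c q) tq.
have hc : h y @[y --> c q] --> h (c q) := hC 0%N (c q) Uq.
have ghx : \forall x \near q, chart_metric q x = h (c x).
  have n1 := inner_near iq.
  have n2 := coord_cvg iq.1 (open_nbhs_nbhs (conj oU Uq)).
  apply: filterS2 n1 n2 => x ix Ux; have [tx kx] := coordK ix.1.
  by have := gh _ tx Ux; rewrite /= kx.
have gq : h (c q) = g q.
  rewrite -(nbhs_singleton ghx) /chart_metric from_chart_id // mul1mx trmx1.
  exact: mulmx1.
apply: cvg_within_filter; rewrite -gq.
apply: (@cvg_near_eq _ _ (nbhs q) (h \o c)).
  by apply: filterS ghx => x ->.
by move=> W /hc; exact: (coord_cvg iq.1).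
Qed.

Lemma section_cvg (X : M -> 'rV[R]_n) q : C1_vector_field X -> Lam q ->
  X x *m to_chart q x @[x --> within Lam (nbhs q)] --> X q.
Proof.
move=> XC1 Lq; have iq := Lam_inner Lq.
set c := chart_at q.
have [tq kq] := coordK iq.1.
have [U [h [oU Uq [hd _] Xh]]] := XC1 q (c q) tq.
have hc : h y @[y --> c q] --> h (c q).
  by apply: differentiable_continuous; exact: hd.
have Xhx : \forall x \near q, X x *m to_chart q x = h (c x).
  have n1 := inner_near iq.
  have n2 := coord_cvg iq.1 (open_nbhs_nbhs (conj oU Uq)).
  apply: filterS2 n1 n2 => x ix Ux; have [tx kx] := coordK ix.1.
  by have := Xh _ tx Ux; rewrite /= kx.
have Xq : h (c q) = X q.
  by rewrite -(nbhs_singleton Xhx) to_chart_id // mulmx1.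
apply: cvg_within_filter; rewrite -Xq.
apply: (@cvg_near_eq _ _ (nbhs q) (h \o c)).
  by apply: filterS Xhx => x ->.
by move=> W /hc; exact: (coord_cvg iq.1).
Qed.

Lemma cont_map_comp psi chi A B : (forall x, Lam x -> Lam (psi x)) ->
  cont_base psi -> cont_map psi A -> cont_map chi B ->
  cont_map (chi \o psi) (fun x => A x *m B (psi x)).
Proof.
move=> psiL psic Ac Bc q Lq.
have Bc' := @cvg_comp _ _ _ psi _ _ _ _ (psic q Lq) (Bc _ (psiL q Lq)).
have near1 : \forall x \near within Lam (nbhs q),
    to_chart (psi q) (psi x) *m from_chart (psi q) (psi x) = 1%:M.
  have near0 : \forall y \near within Lam (nbhs (psi q)),
      to_chart (psi q) y *m from_chart (psi q) y = 1%:M.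
    by apply: filterS (near_chart_inverse (psiL q Lq)) => y [].
  exact: near_comp (psic q Lq) near0.
have h : (from_chart q x *m A x *m to_chart (psi q) (psi x)) *m
    (from_chart (psi q) (psi x) *m B (psi x) *m to_chart (chi (psi q)) (chi (psi x)))
    @[x --> within Lam (nbhs q)] --> A q *m B (psi q).
  exact: (cvg_mulmx (Ac q Lq) Bc').
apply: (cvg_near_eq _ h).
apply: filterS near1 => x hx; exact: mulmx_insert.
Qed.

Let g_sym p : (g p)^T = g p. Proof. by have [h _ _] := hg. Qed.
Let g_pos p (v : 'rV[R]_n) : v != 0 -> 0 < (v *m g p *m v^T) 0 0.
Proof. by have [_ h _] := hg; exact: h. Qed.

Lemma posdef_g p : posdef (g p).
Proof. by split; [exact: g_sym|exact: g_pos]. Qed.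

Lemma chart_metric_posdef q x :
  to_chart q x *m from_chart q x = 1%:M -> from_chart q x *m to_chart q x = 1%:M ->
  posdef (chart_metric q x).
Proof.
move=> TS ST; split; first by rewrite /chart_metric !trmx_mul trmxK g_sym mulmxA.
move=> u u0; rewrite /chart_metric !mulmxA -mulmxA -trmx_mul; apply: g_pos.
by apply: contra_neq u0 => h; rewrite -[u]mulmx1 -ST mulmxA h mul0mx.
Qed.

Lemma chart_metric_form q x (u : 'rV[R]_n) :
  (u *m chart_metric q x *m u^T) 0 0 = tnorm g x (u *m from_chart q x) ^+ 2.
Proof.
rewrite (sqr_tnorm g_pos) /dot /chart_metric trmx_mul !mulmxA.
by [].
Qed.

(** In fixed charts the squared norm of the image is the quadratic form [H], and [quad_form_le]
    bounds it by [k x] times the squared norm of v. As [k] is continuous it stays below [k0 + 1]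
    near [q], and compactness concludes. *)
Lemma cont_map_bounded psi A : (forall x, Lam x -> Lam (psi x)) ->
  cont_base psi -> cont_map psi A ->
  exists K, 0 <= K /\ forall x (v : 'rV[R]_n), Lam x ->
    tnorm g (psi x) (v *m A x) <= K * tnorm g x v.
Proof.
move=> psiL psic Ac.
have [K [K0 hK]] : exists K, 0 <= K /\ forall x, Lam x -> forall v : 'rV[R]_n,
    tnorm g (psi x) (v *m A x) ^+ 2 <= K * tnorm g x v ^+ 2.
  apply: (compact_uniform_bound (P := fun K x => forall v : 'rV[R]_n,
    tnorm g (psi x) (v *m A x) ^+ 2 <= K * tnorm g x v ^+ 2)) => //.
    move=> K K' x KK' h v; apply: le_trans (h v) _.
    by rewrite ler_wpM2r // sqr_ge0.
  move=> q Lq; have Lq' := psiL q Lq.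
  pose G x := chart_metric q x; pose G' x := chart_metric (psi q) (psi x).
  pose B x := from_chart q x *m A x *m to_chart (psi q) (psi x).
  pose H x := B x *m G' x *m (B x)^T.
  have Gc : G x @[x --> within Lam (nbhs q)] --> g q by exact: chart_metric_cvg.
  have G'c : G' x @[x --> within Lam (nbhs q)] --> g (psi q).
    exact: cvg_comp (psic q Lq) (chart_metric_cvg Lq').
  have Bc : B x @[x --> within Lam (nbhs q)] --> A q := Ac q Lq.
  pose H0 := A q *m g (psi q) *m (A q)^T.
  have Hc : H x @[x --> within Lam (nbhs q)] --> H0.
    by apply: cvg_mulmx; [exact: cvg_mulmx|exact: cvg_trmx].
  have gu := posdef_unit (posdef_g q).
  have /cvg_mxP Gic : invmx (G x) @[x --> within Lam (nbhs q)] --> invmx (g q).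
    exact: cvg_invmx.
  move/cvg_mxP: Hc => Hc.
  pose k x := \sum_i \sum_j `|H x i j| * (invmx (G x) i i + invmx (G x) j j).
  pose k0 := \sum_i \sum_j `|H0 i j| * (invmx (g q) i i + invmx (g q) j j).
  have kc : k x @[x --> within Lam (nbhs q)] --> k0.
    apply: cvg_big => [|i _]; first exact: add_continuous.
    apply: cvg_big => [|j _]; first exact: add_continuous.
    apply: cvgM; first by apply: cvg_norm; exact: Hc.
    by apply: cvgD; exact: Gic.
  have near1 : \forall x \near within Lam (nbhs q), k x <= k0 + 1.
    apply: (cvgr_le _ kc); by rewrite ltrDl.
  have near2 := near_chart_inverse Lq.
  have near3 : \forall x \near within Lam (nbhs q),
      to_chart (psi q) (psi x) *m from_chart (psi q) (psi x) = 1%:M.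
    have near0 : \forall y \near within Lam (nbhs (psi q)),
        to_chart (psi q) y *m from_chart (psi q) y = 1%:M.
      by apply: filterS (near_chart_inverse Lq') => y [].
    exact: near_comp (psic q Lq) near0.
  exists (k0 + 1).
  apply: filterS3 near1 near2 near3 => x kx [TS ST] T'S' v.
  pose u := v *m to_chart q x.
  have uS : u *m from_chart q x = v by rewrite /u -mulmxA TS mulmx1.
  have Gp : posdef (G x) by exact: chart_metric_posdef.
  have e1 : (u *m G x *m u^T) 0 0 = tnorm g x v ^+ 2.
    by rewrite -uS; exact: chart_metric_form.
  have e2 : (u *m H x *m u^T) 0 0 = tnorm g (psi x) (v *m A x) ^+ 2.
    have uB : u *m B x *m from_chart (psi q) (psi x) = v *m A x.
      rewrite -uS /B; move: T'S'; move: (from_chart (psi q) _) (to_chart (psi q) _).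
      move=> S' T' T'S'; move: (from_chart q x) => S.
      by rewrite !mulmxA -(mulmxA _ T') T'S' mulmx1.
    rewrite -uB -(chart_metric_form (psi q) (psi x) (u *m B x)) -/(G' x).
    rewrite /H; move: (B x) (G' x) (u) => b c w.
    by rewrite trmx_mul !mulmxA.
  have := quad_form_le q (H x) u Gp; rewrite e1 e2 => /le_trans; apply.
  by apply: ler_wpM2r; [exact: sqr_ge0|exact: kx].
exists (Num.sqrt K); split; first exact: sqrtr_ge0.
move=> x v Lx; rewrite -ler_sqr ?nnegrE ?mulr_ge0 ?sqrtr_ge0 ?tnorm_ge0 //.
by rewrite exprMn (sqr_sqrtr K0) hK.
Qed.

Section Sections.
Variable X : M -> 'rV[R]_n.
Hypotheses (X_cvg : forall q, Lam q ->
    X x *m to_chart q x @[x --> within Lam (nbhs q)] --> X q)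
  (X_neq0 : forall x, Lam x -> X x != 0).

Lemma dot_section_cvg q : Lam q ->
  dot g x (X x) (X x) @[x --> within Lam (nbhs q)] --> dot g q (X q) (X q).
Proof.
move=> Lq; have Xc := X_cvg Lq; have gc := chart_metric_cvg Lq.
have h1 : X x *m to_chart q x *m chart_metric q x *m (X x *m to_chart q x)^T
    @[x --> within Lam (nbhs q)] --> X q *m g q *m (X q)^T.
  by apply: cvg_mulmx; [exact: cvg_mulmx|exact: cvg_trmx].
move/cvg_mxP: h1 => /(_ 0 0) h.
apply: (cvg_near_eq _ h); apply: filterS (near_chart_inverse Lq) => x [TS ST].
rewrite chart_metric_form -mulmxA TS mulmx1.
exact: sqr_tnorm.
Qed.

Lemma section_bounded : exists K c, [/\ 0 < c,
  forall x, Lam x -> tnorm g x (X x) <= K & forall x, Lam x -> c <= tnorm g x (X x)].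
Proof.
have [K [K0 hK]] : exists K, 0 <= K /\ forall x, Lam x -> dot g x (X x) (X x) <= K.
  apply: (compact_uniform_bound (P := fun K x => dot g x (X x) (X x) <= K)) => //.
    by move=> K K' x KK' /le_trans; apply.
  move=> q Lq; exists (dot g q (X q) (X q) + 1).
  by apply: (cvgr_le _ (dot_section_cvg Lq)); rewrite ltrDl.
(* [compact_uniform_bound] needs a property monotone in K, so the lower bound is phrased through its
   reciprocal. *)
have [c [c0 hc]] : exists K, 0 <= K /\ forall x, Lam x -> 1 <= K * dot g x (X x) (X x).
  apply: (compact_uniform_bound (P := fun K x => 1 <= K * dot g x (X x) (X x))) => //.
    move=> K1 K' x KK' /le_trans; apply.
    by rewrite ler_wpM2r // (dot_ge0 g_pos).
  move=> q Lq; pose d := dot g q (X q) (X q).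
  have d0 : 0 < d by apply: g_pos; exact: X_neq0.
  exists (2 / d).
  have : \forall x \near within Lam (nbhs q), d / 2 <= dot g x (X x) (X x).
    by apply: (cvgr_ge _ (dot_section_cvg Lq)); rewrite -/d ltr_pdivrMr // ltr_pMr // ltr1n.
  apply: filterS => x h; have d0' : d != 0 by rewrite gt_eqF.
  have e : 2 / d * (d / 2) = 1 by field.
  rewrite -[leLHS]e.
  by apply: ler_wpM2l => //; rewrite divr_ge0 // ltW.
(* [c] is only known to be nonnegative; adding 1 makes the lower bound positive. *)
exists (Num.sqrt K), (Num.sqrt (c + 1)^-1); split.
- by rewrite sqrtr_gt0 invr_gt0 ltr_wpDl.
- by move=> x Lx; rewrite ler_wsqrtr //; exact: hK.
- move=> x Lx; apply: ler_wsqrtr; rewrite -div1r ler_pdivrMr ?ltr_wpDl //.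
  apply: le_trans (hc x Lx) _; rewrite mulrC ler_wpM2l ?(dot_ge0 g_pos) //.
  by rewrite lerDl.
Qed.

Definition cont_covec (a : M -> 'cV[R]_n) := forall q, Lam q ->
  from_chart q x *m a x @[x --> within Lam (nbhs q)] --> a q.

Lemma cont_along : cont_covec (fun x => along g (X x) x).
Proof.
move=> q Lq; have Xc := X_cvg Lq; have gc := chart_metric_cvg Lq.
have h1 : chart_metric q x *m (X x *m to_chart q x)^T
    @[x --> within Lam (nbhs q)] --> g q *m (X q)^T.
  by apply: cvg_mulmx => //; exact: cvg_trmx.
have dX : dot g q (X q) (X q) != 0.
  by rewrite gt_eqF //; apply: g_pos; exact: X_neq0.
have h2 : (dot g x (X x) (X x))^-1 *: (chart_metric q x *m (X x *m to_chart q x)^T)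
    @[x --> within Lam (nbhs q)] --> along g (X q) q.
  by apply: cvgZ => //; apply: cvgV => //; exact: dot_section_cvg.
apply: (cvg_near_eq _ h2); apply: filterS (near_chart_inverse Lq) => x [TS ST].
rewrite /along -scalemxAr /chart_metric; congr (_ *: _).
move: TS; move: (to_chart q x) (from_chart q x) => T S TS.
by rewrite -!mulmxA -trmx_mul -mulmxA TS mulmx1.
Qed.

End Sections.

End BundleMaps.

(** * Continuity of limit forms, projections and subbundles *)

Section Bundles.
Variables (R : realType) (n : nat) (M : manifold R n) (g : M -> 'M[R]_n)
  (Lam : set M).
Hypotheses (hg : riemannian_metric g)
  (Lam_inner : forall x, Lam x -> inner (chart_at x) x).
Implicit Types (p q x : M) (psi chi : M -> M) (A B P : M -> 'M[R]_n).

Let g_pos p (v : 'rV[R]_n) : v != 0 -> 0 < (v *m g p *m v^T) 0 0.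
Proof. by have [_ h _] := hg; exact: h. Qed.

Lemma cont_map_covec psi A (b : M -> 'cV[R]_n) :
  (forall x, Lam x -> Lam (psi x)) -> cont_base Lam psi ->
  cont_map Lam psi A -> cont_covec Lam b ->
  cont_covec Lam (fun x => A x *m b (psi x)).
Proof.
move=> psiL psic Ac bc q Lq; have Lq' := psiL q Lq.
have bc' : from_chart (psi q) (psi x) *m b (psi x)
    @[x --> within Lam (nbhs q)] --> b (psi q).
  exact: cvg_comp (psic q Lq) (bc _ Lq').
have h : (from_chart q x *m A x *m to_chart (psi q) (psi x)) *m
    (from_chart (psi q) (psi x) *m b (psi x))
    @[x --> within Lam (nbhs q)] --> A q *m b (psi q).
  by apply: cvg_mulmx => //; exact: Ac.
have near0 : \forall y \near within Lam (nbhs (psi q)),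
    to_chart (psi q) y *m from_chart (psi q) y = 1%:M.
  by apply: filterS (near_chart_inverse Lam_inner Lq') => y [].
apply: (cvg_near_eq _ h).
apply: filterS (near_comp (psic q Lq) near0) => x.
move: (to_chart (psi q) _) (from_chart (psi q) _) (from_chart q x) => T S' S TS.
by rewrite !mulmxA -(mulmxA _ T) TS mulmx1.
Qed.

Lemma cont_outer (a : M -> 'cV[R]_n) (X : M -> 'rV[R]_n) :
  cont_covec Lam a ->
  (forall q, Lam q -> X x *m to_chart q x @[x --> within Lam (nbhs q)] --> X q) ->
  cont_map Lam id (fun x => a x *m X x).
Proof.
move=> ac Xc q Lq.
have h : (from_chart q x *m a x) *m (X x *m to_chart q x)
    @[x --> within Lam (nbhs q)] --> a q *m X q.
  by apply: cvg_mulmx; [exact: ac|exact: Xc].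
apply: (cvg_near_eq _ h); apply: nearW => x.
by rewrite !mulmxA.
Qed.

Lemma cont_mapB psi A B : cont_map Lam psi A -> cont_map Lam psi B ->
  cont_map Lam psi (fun x => A x - B x).
Proof.
move=> Ac Bc q Lq.
have h : from_chart q x *m A x *m to_chart (psi q) (psi x) -
    from_chart q x *m B x *m to_chart (psi q) (psi x)
    @[x --> within Lam (nbhs q)] --> A q - B q.
  by apply: cvgB; [exact: Ac|exact: Bc].
apply: (cvg_near_eq _ h); apply: nearW => x /=.
by rewrite mulmxBr mulmxBl.
Qed.

Lemma cont_covec_limit (a_ : nat -> M -> 'cV[R]_n) (a : M -> 'cV[R]_n) (K r : R) :
  0 <= K -> 0 <= r < 1 -> (forall k, cont_covec Lam (a_ k)) ->
  (forall x k (w : 'rV[R]_n), Lam x ->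
    `|(w *m a_ k x) 0 0 - (w *m a x) 0 0| <= K * tnorm g x w * r ^+ k) ->
  cont_covec Lam a.
Proof.
move=> K0 r01 ac ha q Lq.
apply/cvg_mxP => i j; rewrite (ord1 j) {j}.
pose e : 'rV[R]_n := delta_mx 0 i.
have entry (b : 'cV[R]_n) : b i 0 = (e *m b) 0 0 by rewrite /e -rowE mxE.
(* The square of [tnorm g x (e *m from_chart q x)] is a diagonal entry of [chart_metric], close to
   [g q i i]. This turns the uniform estimate in [tnorm] into one on entries in the chart, for a
   three-epsilon argument. *)
pose B := Num.sqrt (g q i i + 1).
have nearB : \forall x \near within Lam (nbhs q), tnorm g x (e *m from_chart q x) <= B.
  have /cvg_mxP/(_ i i) c := chart_metric_cvg hg Lam_inner Lq.
  have : \forall x \near within Lam (nbhs q), chart_metric g q x i i <= g q i i + 1.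
    by apply: (cvgr_le _ c); rewrite ltrDl.
  apply: filterS => x hx; rewrite -(ger0_norm (tnorm_ge0 g x _)) -sqrtr_sqr.
  apply: ler_wsqrtr; rewrite -chart_metric_form // -rowE trmx_delta -colE 2!mxE.
  exact: hx.
have B0 : 0 <= B by exact: sqrtr_ge0.
apply/cvgrPdist_le => d d0.
have d3 : 0 < d / 3 by rewrite divr_gt0.
have [k hk] : exists k, K * B * r ^+ k <= d / 3.
  have c : (fun k => K * B * r ^+ k) @ \oo --> (0 : R).
    rewrite -(mulr0 (K * B)); apply: cvgM; first exact: cvg_cst.
    by apply: cvg_expr; case/andP: r01 => r0 r1; rewrite ger0_norm.
  exact: filter_ex (cvgr_le _ c _ d3).
have /cvg_mxP/(_ i 0)/cvgrPdist_le/(_ _ d3) near2 := ac k q Lq.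
have nL : \forall x \near within Lam (nbhs q), Lam x by exact: withinT.
have est x : Lam x -> tnorm g x (e *m from_chart q x) <= B ->
    `|(from_chart q x *m a_ k x) i 0 - (from_chart q x *m a x) i 0| <= d / 3.
  move=> Lx hB; rewrite !entry !mulmxA; apply: le_trans (ha _ _ _ Lx) _.
  apply: le_trans hk; apply: ler_wpM2r; first by case/andP: r01 => r0 _; exact: exprn_ge0.
  exact: ler_wpM2l.
have Bq : tnorm g q (e *m from_chart q q) <= B.
  by have := nbhs_singleton (nearB : nbhs q [set x | Lam x -> _]); exact.
have estq := est q Lq Bq; rewrite (from_chart_id Lam_inner Lq) !mul1mx in estq.
apply: filterS3 near2 nL nearB => x h2 Lx hB.
have estx := est x Lx hB.
apply: le_trans (ler_distD (a_ k q i 0) _ _) _.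
have -> : d = d / 3 + (d / 3 + d / 3) by field.
apply: lerD; first by rewrite distrC.
apply: le_trans (ler_distD ((from_chart q x *m a_ k x) i 0) _ _) _.
exact: lerD.
Qed.

(* The projection along E onto F is, in the chart at q, a rational function of
   local frames of E and F. *)
Lemma cont_proj (E F : M -> 'M[R]_n) :
  continuous_subbundle Lam E -> continuous_subbundle Lam F ->
  (forall x, Lam x -> row_full (E x + F x)%MS /\ mxdirect (E x + F x)%MS) ->
  cont_map Lam id (fun x => proj_mx (F x) (E x)).
Proof.
move=> Ec Fc EF q Lq.
(* A matrix [Q] with rows in the fibre at [q] extends continuously with rows in nearby fibres: [Q]
   is a combination [C] of the local frame at [q], and [C] is kept constant. *)
have frame (G : M -> 'M[R]_n) (Q : 'M[R]_n) : continuous_subbundle Lam G ->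
    (Q <= G q)%MS -> exists b : M -> 'M[R]_n,
    [/\ b x @[x --> within Lam (nbhs q)] --> Q, b q = Q &
       \forall x \near within Lam (nbhs q), (b x <= G x *m to_chart q x)%MS].
  move=> Gc QG; have [U [b [oU Uq _ bc bG]]] := Gc q Lq.
  have nU := open_nbhs_nbhs (conj oU Uq).
  have /submxP[C QC] : (Q <= b q)%MS.
    have [_ /eqmxP bq] := bG q Lq Uq; rewrite bq.
    have -> : change_coord (chart_at q) (chart_at q) q = 1%:M.
      exact: change_coord_id (Lam_inner Lq).
    by rewrite mulmx1.
  exists (fun x => C *m b x); split; rewrite -?QC //.
    rewrite QC; apply: cvg_mulmx; first exact: cvg_cst.
    move/subspace_continuousP: bc => /(_ q (conj Lq Uq)) bc W /bc bW.
    apply: (@filterS2 _ _ (nbhs_filter q) _ _ _ _ nU bW) => x Ux h Lx.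
    exact: h.
  rewrite near_withinE; apply: filterS nU => x Ux Lx.
  have [_ /eqmxP bx] := bG x Lx Ux.
  by apply: submx_trans (submxMl _ _) _; rewrite bx.
have cap0 x : Lam x -> (E x :&: F x)%MS = 0.
  by move=> Lx; have [_ /mxdirect_addsP] := EF x Lx.
have cap0' x : Lam x -> (F x :&: E x)%MS = 0.
  by move=> Lx; apply/eqP; rewrite -submx0 capmxC submx0 cap0.
have sE : (proj_mx (E q) (F q) <= E q)%MS.
  by rewrite -[X in (X <= _)%MS]mul1mx proj_mx_sub.
have sF : (proj_mx (F q) (E q) <= F q)%MS.
  by rewrite -[X in (X <= _)%MS]mul1mx proj_mx_sub.
have [bE [bEc bEq nE]] := frame E _ Ec sE.
have [bF [bFc bFq nF]] := frame F _ Fc sF.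
have W1 : proj_mx (E q) (F q) + proj_mx (F q) (E q) = 1%:M.
  have [full _] := EF q Lq.
  have := @add_proj_mx _ _ _ (E q) (F q) 1%:M (cap0 q Lq).
  by rewrite !mul1mx; apply; rewrite submx_full.
have Wc : bE x + bF x @[x --> within Lam (nbhs q)] --> (1%:M : 'M[R]_n).
  by rewrite -W1; apply: cvgD.
have one_unit : (1%:M : 'M[R]_n) \in unitmx by exact: unitmx1.
have nW : \forall x \near within Lam (nbhs q), bE x + bF x \in unitmx.
  exact: near_unitmx Wc one_unit.
(* The projection kills [bE] and fixes [bF], so multiplying [bE + bF] by it yields [bF]; that sum is
   near the identity, hence invertible. *)
have h : invmx (bE x + bF x) *m bF x @[x --> within Lam (nbhs q)] -->
    proj_mx (F q) (E q).
  rewrite -[proj_mx (F q) (E q)]mul1mx -(invmx1 R n).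
  by apply: cvg_mulmx => //; apply: cvg_invmx.
apply: (cvg_near_eq _ h).
have nL : \forall x \near within Lam (nbhs q), Lam x by exact: withinT.
have nTS := near_chart_inverse Lam_inner Lq.
near=> x.
have Lx : Lam x by near: x.
have [TS ST] : to_chart q x *m from_chart q x = 1%:M /\
  from_chart q x *m to_chart q x = 1%:M by near: x.
have Wu : bE x + bF x \in unitmx by near: x.
have bEx : (bE x <= E x *m to_chart q x)%MS by near: x.
have bFx : (bF x <= F x *m to_chart q x)%MS by near: x.
have bES : (bE x *m from_chart q x <= E x)%MS.
  by apply: submx_trans (submxMr _ bEx) _; rewrite -mulmxA TS mulmx1.
have bFS : (bF x *m from_chart q x <= F x)%MS.
  by apply: submx_trans (submxMr _ bFx) _; rewrite -mulmxA TS mulmx1.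
have e1 := proj_mx_0 (cap0' x Lx) bES.
have e2 := proj_mx_id (cap0' x Lx) bFS.
apply: (can_inj (mulKmx Wu)).
rewrite mulKVmx // /=.
move: TS ST e1 e2; move: (to_chart q x) (from_chart q x) (proj_mx _ _) => T S P.
move=> TS ST e1 e2.
by rewrite !mulmxA mulmxDl mulmxDl e1 e2 add0r -mulmxA ST mulmx1.
Unshelve. all: by end_near. Qed.

(** A basis of the fibre at [q], pushed by the projection at nearby points, remains independent by
    continuity and spans because the rank is constant. *)
Lemma idempotent_subbundle (P G : M -> 'M[R]_n) (k : nat) :
  cont_map Lam id P -> (forall x, Lam x -> P x *m P x = P x) ->
  (forall x, Lam x -> (G x :=: P x)%MS) ->
  (forall x, Lam x -> \rank (G x) = k) -> continuous_subbundle Lam G.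
Proof.
move=> Pc PK GP Gr q Lq.
pose Q x := from_chart q x *m P x *m to_chart q x.
pose B x := row_base (G q) *m Q x.
have Bc : B x @[x --> within Lam (nbhs q)] --> row_base (G q).
  have /submxP[C CP] : (row_base (G q) <= P q)%MS by rewrite eq_row_base GP.
  have -> : row_base (G q) = row_base (G q) *m P q.
    by rewrite {2}CP -mulmxA PK.
  by apply: cvg_mulmx; [exact: cvg_cst|exact: Pc].
have Bfree : \forall x \near within Lam (nbhs q), row_free (B x).
  (* The pseudo-inverse is a right inverse at [q], so this product is near the identity, and its
     invertibility forces the rows of [B x] to be independent. *)
  have c : B x *m pinvmx (row_base (G q)) @[x --> within Lam (nbhs q)] -->
      (1%:M : 'M[R]_(\rank (G q))).
    rewrite -(mulmxVp (row_base_free (G q))).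
    by apply: cvg_mulmx => //; exact: cvg_cst.
  have one_unit : (1%:M : 'M[R]_(\rank (G q))) \in unitmx by exact: unitmx1.
  apply: filterS (near_unitmx c one_unit) => x.
  rewrite -row_free_unit -!row_leq_rank => h.
  by apply: leq_trans h _; exact: mxrankM_maxl.
have iq := Lam_inner Lq.
have nq := inner_near iq.
pose V := [set x | inner (chart_at q) x /\
  (Lam x -> row_free (B x) /\ to_chart q x *m from_chart q x = 1%:M)].
have nV : nbhs q V.
  have nTS := near_chart_inverse Lam_inner Lq.
  rewrite near_withinE in nTS; rewrite near_withinE in Bfree.
  apply: (@filterS3 _ _ (nbhs_filter q) _ _ _ _ _ nq nTS Bfree) => x ix h1 h2.
  split; first exact: ix.
  by move=> Lx; split; [exact: (h2 Lx)|exact: (h1 Lx).1].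
exists V°, B; split.
- exact: open_interior.
- exact: nV.
- by move=> x /interior_subset [[]].
(* Continuity is required at every [y] of the neighbourhood, while [Pc] speaks of the chart at [y].
   Coordinate changes between the two fixed charts at [y] and [q] link them. *)
- apply/subspace_continuousP => y [Ly /interior_subset [iy _]].
  have iyy := Lam_inner Ly.
  apply: cvg_mulmx; first exact: cvg_cst.
  have c1 : change_coord (chart_at y) (chart_at q) x @[x --> within Lam (nbhs y)] -->
      to_chart q y.
    by rewrite to_chartE; apply: cvg_within_filter; exact: (change_coord_near iyy iy.1).2.
  have c2 : change_coord (chart_at q) (chart_at y) x @[x --> within Lam (nbhs y)] -->
      from_chart q y.
    by rewrite from_chartE; apply: cvg_within_filter; exact: (change_coord_near iy iyy.1).2.
  have c3 : from_chart y x *m P x *m to_chart y x @[x --> within Lam (nbhs y)] --> P y.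
    exact: Pc.
  have h : change_coord (chart_at q) (chart_at y) x *m
      (from_chart y x *m P x *m to_chart y x) *m
      change_coord (chart_at y) (chart_at q) x
      @[x --> within Lam (nbhs y)] --> from_chart q y *m P y *m to_chart q y.
    exact: (cvg_mulmx (cvg_mulmx c2 c3) c1).
  have sub : within (Lam `&` V°) (nbhs y) `=>` within Lam (nbhs y).
    move=> W hW; apply: (@filterS _ _ (nbhs_filter y) _ _ _ hW) => x hx [Lx _].
    exact: hx.
  have {}h := cvg_trans (cvg_app _ sub) h.
  apply: (cvg_near_eq _ h); rewrite near_withinE.
  have n1 := inner_near iyy; have n2 := inner_near iy.
  apply: (@filterS2 _ _ (nbhs_filter y) _ _ _ _ n1 n2) => x ix ixq [Lx _].
  have ixx := Lam_inner Lx.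
  have eT : to_chart y x *m change_coord (chart_at y) (chart_at q) x = to_chart q x.
    by rewrite !to_chartE; apply: change_coordM => //; exact: ixq.1.
  have eS : change_coord (chart_at q) (chart_at y) x *m from_chart y x = from_chart q x.
    by rewrite !from_chartE; apply: change_coordM => //; exact: ixx.1.
  rewrite /Q -eT -eS; move: (to_chart y x) (from_chart y x) (P x) => T S p.
  move: (change_coord _ _ _) (change_coord _ _ _) => c c'.
  by rewrite !mulmxA.
move=> y Ly /interior_subset [iy /(_ Ly) [Bf TS]]; split => //.
have GPT := eqmxMr (to_chart q y) (GP y Ly).
have BP : (B y <= G y *m to_chart q y)%MS.
  rewrite GPT /B /Q; move: (to_chart q y) (from_chart q y) => T S.
  by rewrite !mulmxA -(mulmxA _ (P y)) submxMl.
rewrite -to_chartE -(mxrank_leqif_eq BP) (eqP Bf) mxrankMfree ?Gr //.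
by rewrite row_free_unit; exact: (mulmx1_unit TS).1.
Qed.

End Bundles.

(** * The hyperbolic splitting *)

Section SectionalExpansion.
Variables (R : realType) (n : nat) (M : manifold R n) (g : M -> 'M[R]_n).
Hypotheses (g_sym : forall p, (g p)^T = g p)
  (g_pos : forall p (v : 'rV[R]_n), v != 0 -> 0 < (v *m g p *m v^T) 0 0).

(** The Gram determinant is nonzero, so the Gram matrix, and with it its left factor, has full
    rank. *)
Lemma row_free_perp p (x v : 'rV[R]_n) :
  x != 0 -> perp g x p v != 0 -> row_free (col_mx x v).
Proof.
move=> x0 Pv0.
have dG : \det (gram g p (col_mx x v)) != 0.
  rewrite det_gram2 // expf_eq0 /= mulf_eq0 !(tnorm_eq0 g_pos).
  by rewrite (negPf x0) (negPf Pv0).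
have := row_free_unit (gram g p (col_mx x v)); rewrite unitmxE unitfE dG.
rewrite -!row_leq_rank => /leq_trans; apply.
by rewrite /gram -mulmxA; exact: mxrankM_maxl.
Qed.

Lemma absdet_perp p q (A P : 'M[R]_n) (x v : 'rV[R]_n) :
  x != 0 -> x *m A != 0 -> perp g x p v != 0 -> (P :=: col_mx x v)%MS ->
  absdet g p q A P =
  (tnorm g q (x *m A) * tnorm g q (perp g (x *m A) q (v *m A))) /
  (tnorm g p x * tnorm g p (perp g x p v)).
Proof.
move=> x0 xA0 Pv0 PW; rewrite (absdetE _ _ _ _ (row_free_perp x0 Pv0) PW) //.
rewrite mul_col_mx !det_gram2 // !sqrtr_sqr !ger0_norm ?mulr_ge0 ?tnorm_ge0 //.
Qed.

End SectionalExpansion.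

Lemma cont_base_flow (R : realType) (n : nat) (M : manifold R n)
    (X : M -> 'rV[R]_n) (D : set (R * M)) (phi : R -> M -> M) (Lam : set M) t :
  inwardly_transverse X -> is_flow X D phi -> invariant_set D phi Lam ->
  cont_base Lam (phi t).
Proof.
move=> hXin hphi hLinv q Lq W hW.
have := flow_cvg (t := t) hXin hphi hLinv Lq hW.
by apply: (@filterS _ _ (nbhs_filter q)) => x h Lx; apply: h; exact: (invariant_flow hLinv).
Qed.

Lemma cont_map_dflow (R : realType) (n : nat) (M : manifold R n)
    (X : M -> 'rV[R]_n) (D : set (R * M)) (phi : R -> M -> M) (Lam : set M) t :
  inwardly_transverse X -> is_flow X D phi -> invariant_set D phi Lam ->
  cont_map Lam (phi t) (dflow D phi t).
Proof.
move=> hXin hphi hLinv q Lq.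
apply: (cvg_near_eq _ (dflow_cvg (t := t) hXin hphi hLinv Lq)).
by apply: nearW => x; rewrite from_chartE to_chartE.
Qed.

Theorem corollary1 (R : realType) (n : nat) (M : manifold R n)
    (g : M -> 'M[R]_n) (X : M -> 'rV[R]_n)
    (D : set (R * M)) (phi : R -> M -> M)
    (Lam : set M) (E F : M -> 'M[R]_n)
    (hn : (3 <= n)%N)
    (hMcompact : compact [set: M]) (hMconnected : connected [set: M])
    (hg : riemannian_metric g)
    (hX : C1_vector_field X) (hXin : inwardly_transverse X)
    (hphi : is_flow X D phi)
    (hLcompact : compact Lam) (hLinv : invariant_set D phi Lam)
    (hLsing : forall x, Lam x -> X x <> 0)
    (hEcont : continuous_subbundle Lam E)
    (hFcont : continuous_subbundle Lam F)
    (hEinv : invariant_subbundle D phi Lam E)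
    (hFinv : invariant_subbundle D phi Lam F)
    (hEF : forall x, Lam x ->
       row_full (E x + F x)%MS /\ mxdirect (E x + F x)%MS)
    (hE : uniformly_contracted g D phi Lam E)
    (hF : sectionally_expanding g D phi Lam F) :
  hyperbolic_set g D phi Lam X.
Proof.
have [g_sym g_pos _] := hg.
have inn := invariant_inner hXin hphi hLinv.
pose A := dflow D phi.
pose pF x := proj_mx (F x) (E x).
have X0 x : Lam x -> X x != 0 by move=> Lx; apply/eqP; exact: hLsing.
have phiL t x : Lam x -> Lam (phi t x) by exact: (invariant_flow hLinv).
have phi0 := flow0 hphi.
have phiD s t x : Lam x -> phi s (phi t x) = phi (t + s) x.
  by move=> Lx; apply: (flowD hphi); exact: invariant_dom.
have A0 x : Lam x -> A 0 x = 1%:M by exact: (dflow0 hXin hphi hLinv).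
have AD s t x : Lam x -> A t x *m A s (phi t x) = A (t + s) x.
  exact: (dflowD hXin hphi hLinv).
have XA t x : Lam x -> X x *m A t x = X (phi t x).
  exact: (X_dflow hXin hphi hLinv).
have capEF x : Lam x -> (E x :&: F x)%MS = 0.
  by move=> Lx; have [_ /mxdirect_addsP] := hEF x Lx.
have capFE x : Lam x -> (F x :&: E x)%MS = 0.
  by move=> Lx; apply/eqP; rewrite -submx0 capmxC submx0 capEF.
have subF x m (w : 'M[R]_(m, n)) : (w *m pF x <= F x)%MS by exact: proj_mx_sub.
have subE x m (w : 'M[R]_(m, n)) : Lam x -> (w - w *m pF x <= E x)%MS.
  move=> Lx; apply: proj_mx_compl_sub; rewrite addsmxC.
  by apply: submx_full; exact: (hEF x Lx).1.
have inF x m (w : 'M[R]_(m, n)) : Lam x -> (w <= F x)%MS -> w *m pF x = w.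
  by move=> Lx; apply: proj_mx_id; exact: capFE.
have inE x m (w : 'M[R]_(m, n)) : Lam x -> (w <= E x)%MS -> w *m pF x = 0.
  by move=> Lx; apply: proj_mx_0; exact: capFE.
have pFK x : Lam x -> pF x *m pF x = pF x.
  by move=> Lx; apply: inF => //; rewrite -[pF x]mul1mx.
have pFA t x : Lam x -> pF x *m A t x = A t x *m pF (phi t x).
  move=> Lx; have Ly := phiL t x Lx.
  have hEt : ((1%:M - 1%:M *m pF x) *m A t x <= E (phi t x))%MS.
    by apply: submx_trans (submxMr _ (subE x _ 1%:M Lx)) _; rewrite (eqmxP (hEinv t x Lx)).
  have hFt : (1%:M *m pF x *m A t x <= F (phi t x))%MS.
    by apply: submx_trans (submxMr _ (subF x _ 1%:M)) _; rewrite (eqmxP (hFinv t x Lx)).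
  have := inE _ _ _ Ly hEt; have := inF _ _ _ Ly hFt.
  rewrite !mul1mx mulmxBl mul1mx mulmxBl => -> /eqP.
  by rewrite subr_eq0 => /eqP.
have [CE [lE [CE0 lE0 hCE]]] := hE.
have contraction x t (v : 'rV[R]_n) : Lam x -> 0 <= t ->
    tnorm g (phi t x) ((v - v *m pF x) *m A t x) <=
    CE * expR (- (lE * t)) * tnorm g x (v - v *m pF x).
  move=> Lx t0; have c0 : 0 <= CE * expR (- (lE * t)).
    by rewrite mulr_ge0 ?expR_ge0 // ltW.
  by apply: ((opnormP g_sym g_pos _ _ _ _ c0).1 (hCE x t Lx t0)); exact: subE.
have Xc q : Lam q -> X x *m to_chart q x @[x --> within Lam (nbhs q)] --> X q.
  exact: (section_cvg inn hX).
have [KX [cX [cX0 N_X_le N_X_ge]]] :=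
  section_bounded hg inn hLcompact Xc X0.
have pFc : cont_map Lam id pF by exact: (cont_proj inn hEcont hFcont hEF).
have idc : cont_base Lam (id : M -> M) by move=> q Lq.
have [KF [_ N_pF]] := cont_map_bounded hg inn hLcompact (fun x Lx => Lx) idc pFc.
have phic t := cont_base_flow (t := t) hXin hphi hLinv.
have Ac t : cont_map Lam (phi t) (A t) := cont_map_dflow (t := t) hXin hphi hLinv.
have N_A s : exists K, forall x (v : 'rV[R]_n), Lam x ->
    tnorm g (phi s x) (v *m A s x) <= K * tnorm g x v.
  have [K [_ hK]] := cont_map_bounded hg inn hLcompact (phiL s) (phic s) (Ac s).
  by exists K.
have XF x : Lam x -> X x *m pF x = X x.
  exact: (X_in_F g_sym g_pos phiL phi0 phiD XA pFA (ltW CE0) lE0 cX0 contraction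
    N_X_le N_X_ge N_pF).
have [[k k2 rankF] [CF [lF [CF0 lF0 hCF]]]] := hF.
have expansion t x (v : 'rV[R]_n) : Lam x -> v *m pF x = v -> 0 < t ->
    CF * expR (lF * t) * (tnorm g x (X x) * tnorm g x (perp g (X x) x v)) <=
    tnorm g (phi t x) (X (phi t x)) *
    tnorm g (phi t x) (perp g (X (phi t x)) (phi t x) (v *m A t x)).
  move=> Lx vF t0; have x0 := X0 x Lx; have y0 := X0 _ (phiL t x Lx).
  (* When [v] is parallel to X there is no plane to expand, but the left-hand side vanishes. *)
  have [->|Pv0] := eqVneq (perp g (X x) x v) 0.
    by rewrite (tnorm0 g_pos) !mulr0 mulr_ge0 ?tnorm_ge0.
  have Wf := row_free_perp g_sym g_pos x0 Pv0.
  pose P := <<col_mx (X x) v>>%MS.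
  have PW : (P :=: col_mx (X x) v)%MS by exact: genmxE.
  have rP : \rank P = 2%N by rewrite PW; exact/eqP.
  have PF : (P <= F x)%MS.
    by rewrite PW col_mx_sub -{1}(XF x Lx) -{1}vF !subF.
  have := hCF x P Lx PF rP t t0.
  have xA : X x *m dflow D phi t x != 0 by rewrite -/(A t x) XA.
  rewrite (absdet_perp g_sym g_pos _ x0 xA Pv0 PW) -/(A t x) XA //.
  rewrite ltr_pdivlMr => [/ltW //|].
  by rewrite mulr_gt0 ?tnorm_gt0.
clearbody pF.
have [a [K [Ka [[Ka0 ha] pFa Xa Aa [K0 hK]]]]] :=
  invariant_form g_sym g_pos phiL phi0 phiD A0 AD XA X0 pFK pFA (ltW CE0) lE0 cX0
    contraction N_X_le N_X_ge N_pF CF0 lF0 N_A expansion.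
(* [a] is the uniform limit of the forms pulled back from integer times, each a composite of [pF],
   DX at time -j and [along], all continuous. *)
have ac : cont_covec Lam a.
  apply: (cont_covec_limit hg inn Ka0 (expRN_itv lF0) _ ha) => j.
  have pAc := cont_map_comp inn (fun x Lx => Lx) idc pFc (Ac (- j%:R)).
  have psiL x : Lam x -> Lam ((phi (- j%:R) \o id) x) by exact: phiL.
  exact: (cont_map_covec inn psiL (phic (- j%:R)) pAc (cont_along hg inn Xc X0)).
have aXc := cont_outer ac Xc.
have Qc := cont_mapB pFc aXc.
pose Q x := pF x - a x *m X x.
have QK x : Lam x -> Q x *m Q x = Q x.
  move=> Lx; rewrite /Q mulmxBl !mulmxBr -!mulmxA XF // (mulmxA (X x)) Xa // mul1mx.
  by rewrite (mulmxA (pF x)) pFa // pFK // subrr subr0.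
have Qa x : Lam x -> Q x *m a x = 0.
  by move=> Lx; rewrite /Q mulmxBl -mulmxA Xa // mulmx1 pFa // subrr.
have QpF x : Lam x -> Q x *m pF x = Q x.
  by move=> Lx; rewrite /Q mulmxBl -mulmxA XF // pFK.
have pFQ x : Lam x -> pF x *m Q x = Q x.
  by move=> Lx; rewrite /Q mulmxBr mulmxA pFa // pFK.
have XQ x : Lam x -> X x *m Q x = 0.
  by move=> Lx; rewrite /Q mulmxBr mulmxA XF // Xa // mul1mx subrr.
have QA t x : Lam x -> Q x *m A t x = A t x *m Q (phi t x).
  by move=> Lx; rewrite /Q mulmxBl mulmxBr pFA // mulmxA Aa // -mulmxA XA.
have inQ x m (w : 'M[R]_(m, n)) : Lam x -> (w <= Q x)%MS -> w *m Q x = w.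
  by move=> Lx /submxP[u ->]; rewrite -mulmxA QK.
have cap1 x : Lam x -> (E x :&: <<X x>>)%MS = 0.
  move=> Lx; set W := (_ :&: _)%MS.
  have /(inE _ _ _ Lx) WE : (W <= E x)%MS by exact: capmxSl.
  have /submxP[u Wu] : (W <= X x)%MS by rewrite -(genmxE (X x)) capmxSr.
  by rewrite -WE Wu -mulmxA XF.
(* On the intersection [Q x] acts as the identity, and it kills both E and X. *)
have cap2 x : Lam x -> ((E x + <<X x>>) :&: Q x)%MS = 0.
  move=> Lx; set W := (_ :&: _)%MS.
  have /(inQ _ _ _ Lx) <- : (W <= Q x)%MS by exact: capmxSr.
  apply/sub_kermxP; apply: submx_trans (capmxSl _ _) _.
  rewrite addsmx_sub; apply/andP; split; apply/sub_kermxP.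
    by rewrite -pFQ // mulmxA (inE x _ (E x)) // mul0mx.
  by apply/eqP; rewrite -submx0 (eqmxMr _ (genmxE _)) XQ // submx0.
have full x : Lam x -> row_full (E x + <<X x>> + Q x)%MS.
  move=> Lx; rewrite -sub1mx.
  have -> : 1%:M = (1%:M - 1%:M *m pF x) + a x *m X x + Q x.
    by rewrite /Q mul1mx -addrA [a x *m X x + _]addrC !subrK.
  apply: addmx_sub_adds; last exact: submx_refl.
  by apply: addmx_sub_adds; [exact: subE|rewrite genmxE submxMl].
have rankX x : Lam x -> \rank <<X x>>%MS = 1%N.
  by move=> Lx; rewrite genmxE rank_rV X0.
(* The constant dimension of F enters here: the rank of [Q x] must not depend on x for the unstable
   bundle to have local frames. As [k] is at least 2, [k - 1] is not truncated. *)
have rankQ x : Lam x -> \rank (Q x) = (k - 1)%N.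
  move=> Lx.
  have h1 : \rank (E x + <<X x>> + Q x)%MS = n by exact/eqP/full.
  have h2 : \rank (E x + F x)%MS = n by apply/eqP; exact: (hEF x Lx).1.
  rewrite mxrank_disjoint_sum ?cap2 // mxrank_disjoint_sum ?cap1 // rankX // in h1.
  rewrite mxrank_disjoint_sum ?capEF // rankF // in h2.
  apply: (@addnI (\rank (E x) + 1)); rewrite h1 -addnA subnKC.
    exact: esym h2.
  exact: ltnW.
split => //; exists E, Q; split.
- split => //; last exact: (idempotent_subbundle inn Qc QK _ rankQ).
  (* Since a(X) = 1, the map a X is idempotent, and X = X a X shows that its row space is the whole
     line of X. *)
  apply: (idempotent_subbundle inn aXc _ _ rankX) => x Lx.
    by rewrite mulmxA -(mulmxA (a x)) Xa // mulmx1.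
  apply/eqmxP/andP; split; last by rewrite genmxE submxMl.
  by rewrite genmxE -{1}[X x]mul1mx -(Xa x Lx) -mulmxA submxMl.
- split => //.
    move=> t x Lx; apply/eqmxP.
    apply: eqmx_trans (eqmxMr _ (genmxE _)) _; rewrite XA //.
    exact: eqmx_sym (genmxE _).
  move=> t x Lx; apply/andP; split; first by rewrite QA // submxMl.
  have Ly := phiL t x Lx.
  (* The reverse inclusion uses the inverse DX_{-t} and the commutation of [Q] with the flow. *)
  have -> : Q (phi t x) = A (- t) (phi t x) *m (Q x *m A t x).
    rewrite QA // mulmxA.
    have e : phi (- t) (phi t x) = x by rewrite phiD // subrr phi0.
    by rewrite -{3}e AD // addNr A0 // mul1mx.
  exact: submxMl.
- move=> x Lx; split; first exact: full.
  by rewrite mxdirect_addsE mxdirect_addsE /= cap1 // cap2 // !eqxx !mxdirect_trivial.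
(* One pair of constants must serve both bundles: the sum of the two factors and the smaller of the
   two rates. *)
pose l := Num.min lE lF; exists (CE + K), l.
have l0 : 0 < l by rewrite lt_min lE0.
split => //; first by rewrite ltr_wpDr.
move=> x t Lx t0.
have CK t' : 0 <= (CE + K) * expR (- (l * t')).
  by rewrite mulr_ge0 ?expR_ge0 // addr_ge0 // ltW.
split; apply/(opnormP g_sym g_pos _ _ _ _ (CK t)) => v vV.
  have := contraction x t v Lx t0; rewrite (inE x _ v) // subr0 => /le_trans; apply.
  rewrite ler_wpM2r ?tnorm_ge0 //.
  apply: ler_pM; [exact: ltW|exact: expR_ge0|by rewrite lerDl|].
  by rewrite ler_expR lerN2 ler_wpM2r // ge_min lexx.
have vQ := inQ x _ v Lx vV.
have vF : v *m pF x = v by rewrite -{1}vQ -mulmxA QpF.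
have va : v *m a x = 0 by rewrite -vQ -mulmxA Qa // mulmx0.
apply: le_trans (hK x t v Lx t0 vF va) _.
rewrite ler_wpM2r ?tnorm_ge0 //.
apply: ler_pM; [exact: K0|exact: expR_ge0|by rewrite lerDr ltW|].
by rewrite ler_expR lerN2 ler_wpM2r // ge_min lexx orbT.
Qed.
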